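(* Let $R$ be a commutative Noetherian ring with identity, let $\mathfrak{a}$ be a non-zero ideal of $R$, and let $M$ be a $ZD$-module over $R$. The following are equivalent: (i) $\Gamma_{\mathfrak{a}}(M/N)$ is Artinian for any submodule $N$ of $M$. (ii) $H^i_{\mathfrak{a}}(M/N)$ is Artinian for any submodule $N$ of $M$ and all $i\geq 0$.
   Context: All modules are unitary. For an $R$-module $X$, $\mathrm{Z}_R(X)$ denotes the set of zero divisors on $X$, i.e. the elements $r\in R$ with $rx=0$ for some non-zero $x\in X$, and $\mathrm{Ass}_R(X)$ denotes the set of associated prime ideals of $X$. An $R$-module $M$ is called a $ZD$-module if for every submodule $N$ of $M$, the set $\mathrm{Z}_R(M/N)$ is a union of finitely many prime ideals belonging to $\mathrm{Ass}_R(M/N)$. The $\mathfrak{a}$-torsion submodule of an $R$-module $X$ is $\Gamma_{\mathfrak{a}}(X)=\bigcup_{n\in\mathbb{N}}(0:_X\mathfrak{a}^n)$, where $(0:_X\mathfrak{a}^n)=\{x\in X:\mathfrak{a}^n x=0\}$. For $i\ge 0$, the local cohomology functor $H^i_{\mathfrak{a}}(\cdot)$ is the $i$-th right derived functor of $\Gamma_{\mathfrak{a}}(\cdot)$; equivalently $H^i_{\mathfrak{a}}(X)\cong\varinjlim_n \mathrm{Ext}^i_R(R/\mathfrak{a}^n,X)$. *)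

(* Defs.v *)
From HB Require Import structures.
From mathcomp Require Import all_boot all_algebra.
From mathcomp Require Import boolp.

Set Implicit Arguments.
Unset Strict Implicit.
Unset Printing Implicit Defensive.

Import GRing.Theory.
Local Open Scope ring_scope.
Local Open Scope quotient_scope.

(* Submodules of [V : lmodType R] are [N : submodClosed V], ideals of [R] are
   submodules of [R^o], hence possibly equal to [R]. Membership is boolean, but
   [boolp] makes every [Prop]-valued predicate boolean. *)

Section SubAndQuotientModules.
Variables (R : pzRingType) (V : lmodType R) (N : submodClosed V).

Record submod := Submod { submod_val :> V; submod_mem : submod_val \in N }.
HB.instance Definition _ := [isSub for submod_val].
HB.instance Definition _ := [Choice of submod by <:].
HB.instance Definition _ := [SubChoice_isSubLmodule of submod by <:].

(* The library does not derive closure under opposite from [submodClosed]. *)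
Definition submod_pred : {pred V} := fun x => x \in N.

Fact submod_pred_zmod_closed : zmod_closed submod_pred.
Proof.
split=> [|x y xN yN]; rewrite unfold_in; first exact: rpred0.
by rewrite rpredD // -scaleN1r rpredZ.
Qed.

HB.instance Definition _ :=
  GRing.isZmodClosed.Build V submod_pred submod_pred_zmod_closed.

Definition quotmod := Quotient.quot submod_pred.
HB.instance Definition _ := GRing.Zmodule.on quotmod.
HB.instance Definition _ :=
  EqQuotient.copy quotmod (Quotient.quot submod_pred).

Definition quotmod_scale (c : R) (x : quotmod) : quotmod :=
  \pi_quotmod (c *: repr x).

Lemma quotmod_eq (x y : V) :
  (\pi_quotmod x == \pi_quotmod y) = (x - y \in N).
Proof. by rewrite -[LHS]Quotient.idealrBE. Qed.

Lemma quotmod_pi_scale (c : R) (x : V) :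
  quotmod_scale c (\pi_quotmod x) = \pi_quotmod (c *: x).
Proof.
apply/eqP; rewrite quotmod_eq -scalerBr rpredZ //.
by rewrite -quotmod_eq reprK.
Qed.

Lemma quotmod_pi_add (x y : V) :
  \pi_quotmod (x + y) = \pi_quotmod x + \pi_quotmod y.
Proof. exact: Quotient.pi_add. Qed.

Fact quotmod_scaleA (c d : R) (x : quotmod) :
  quotmod_scale c (quotmod_scale d x) = quotmod_scale (c * d) x.
Proof. by rewrite -(reprK x) !quotmod_pi_scale reprK scalerA. Qed.

Fact quotmod_scale1 : left_id 1 quotmod_scale.
Proof. by move=> x; rewrite -(reprK x) quotmod_pi_scale scale1r. Qed.

Fact quotmod_scaleDr : right_distributive quotmod_scale +%R.
Proof.
move=> c x y; rewrite -(reprK x) -(reprK y).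
by rewrite -quotmod_pi_add !quotmod_pi_scale scalerDr quotmod_pi_add.
Qed.

Fact quotmod_scaleDl (x : quotmod) :
  {morph quotmod_scale^~ x : c d / c + d}.
Proof.
by move=> c d; rewrite -(reprK x) !quotmod_pi_scale scalerDl quotmod_pi_add.
Qed.

HB.instance Definition _ := GRing.Zmodule_isLmodule.Build R quotmod
  quotmod_scaleA quotmod_scale1 quotmod_scaleDr quotmod_scaleDl.

End SubAndQuotientModules.

Section ChainConditions.
Variables (R : pzRingType) (V : lmodType R).

Definition noetherian : Prop :=
  forall C : nat -> submodClosed V,
    (forall n, {subset C n <= C n.+1}) ->
    exists n, forall m, (n <= m)%N -> C m =i C n.

Definition artinian : Prop :=
  forall C : nat -> submodClosed V,
    (forall n, {subset C n.+1 <= C n}) ->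
    exists n, forall m, (n <= m)%N -> C m =i C n.

End ChainConditions.

Section ZDModules.
Variable R : comNzRingType.

Definition zero_divisor_on (V : lmodType R) (r : R) : Prop :=
  exists2 x : V, x != 0 & r *: x = 0.

Definition associated_prime (V : lmodType R) (p : prime_idealr R) : Prop :=
  exists x : V, forall r : R, (r \in p) = (r *: x == 0).

Definition ZD_module (V : lmodType R) : Prop :=
  forall N : submodClosed V,
    exists (n : nat) (p : 'I_n -> prime_idealr R),
      (forall i, associated_prime (quotmod N) (p i)) /\
      (forall r, zero_divisor_on (quotmod N) r <-> exists i, r \in p i).

End ZDModules.

Section Torsion.
Variable R : comNzRingType.

Definition idealM (I J : {pred R}) : {pred R} := fun r =>
  `[< exists s : seq (R * R),
        (forall p, p \in s -> p.1 \in I /\ p.2 \in J) /\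
        r = \sum_(p <- s) p.1 * p.2 >].

Definition idealX (I : {pred R}) (n : nat) : {pred R} :=
  iter n (idealM I) predT.

Lemma idealXS (I : {pred R}) n : {subset idealX I n.+1 <= idealX I n}.
Proof.
elim: n => [|n IHn] r //= /asboolP[s [sIJ ->]].
by apply/asboolP; exists s; split=> // p /sIJ[pI /IHn].
Qed.

Lemma idealX_sub (I : {pred R}) m n :
  (m <= n)%N -> {subset idealX I n <= idealX I m}.
Proof.
elim: n => [|n IHn]; first by rewrite leqn0 => /eqP->.
rewrite leq_eqVlt => /predU1P[-> //|]; rewrite ltnS => /IHn nm r /idealXS.
exact: nm.
Qed.

Variables (I : submodClosed R^o) (V : lmodType R).

Definition torsion : {pred V} := fun x =>
  `[< exists n, forall r, r \in idealX (I : {pred R}) n -> r *: x = 0 >].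

Lemma torsion_subsemimod_closed : subsemimod_closed torsion.
Proof.
split; first split.
- by apply/asboolP; exists 0 => r _; rewrite scaler0.
- move=> x y /asboolP[m xm] /asboolP[n yn].
  apply/asboolP; exists (maxn m n) => r rmn.
  by rewrite scalerDr xm ?yn ?addr0 //;
    apply: idealX_sub rmn; rewrite ?leq_maxl ?leq_maxr.
- move=> c x /asboolP[n xn]; apply/asboolP; exists n => r rn.
  by rewrite scalerA mulrC -scalerA xn ?scaler0.
Qed.

HB.instance Definition _ :=
  GRing.isSubmodClosed.Build R V torsion torsion_subsemimod_closed.

Definition Gamma : lmodType R := submod torsion.

End Torsion.

Arguments torsion {R} I V _.

Section GammaFunctor.
Variables (R : comNzRingType) (I : submodClosed R^o) (U V : lmodType R).
Variable f : {linear U -> V}.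

Lemma torsion_linear x : x \in torsion I U -> f x \in torsion I V.
Proof.
move=> /asboolP[n xn]; apply/asboolP; exists n => r rn.
by rewrite -linearZ /= xn // linear0.
Qed.

Definition Gamma_map (x : Gamma I U) : Gamma I V :=
  Sub (f (val x)) (torsion_linear (valP x)).

Fact Gamma_map_linear : linear Gamma_map.
Proof. by move=> c x y; apply: val_inj; rewrite /= linearP. Qed.

HB.instance Definition _ :=
  GRing.isLinear.Build R (Gamma I U) (Gamma I V) _ Gamma_map Gamma_map_linear.

End GammaFunctor.

Arguments Gamma_map {R} I {U V} f x.

Section Cohomology.
Variable R : pzRingType.

Record cochain_complex := CochainComplex {
  cc_mod :> nat -> lmodType R;
  cc_d : forall i, {linear cc_mod i -> cc_mod i.+1};
  cc_dd : forall i x, cc_d i.+1 (cc_d i x) = 0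
}.

Variables (C : cochain_complex) (i : nat).

Definition cocycle : {pred C i} := fun x => cc_d C i x == 0.

Fact cocycle_subsemimod_closed : subsemimod_closed cocycle.
Proof.
split; first split; rewrite /cocycle ?unfold_in.
- by rewrite linear0.
- by move=> x y /eqP dx /eqP dy; apply/eqP; rewrite linearD /= dx dy addr0.
- by move=> c x /eqP dx; apply/eqP; rewrite linearZ /= dx scaler0.
Qed.

HB.instance Definition _ :=
  GRing.isSubmodClosed.Build R (C i) cocycle cocycle_subsemimod_closed.

End Cohomology.

Arguments cocycle {R} C i _.

Section CohomologyModule.
Variables (R : pzRingType) (C : cochain_complex R) (i : nat).

Definition coboundary : {pred submod (cocycle C i)} :=
  match i return {pred submod (cocycle C i)} with
  | 0 => fun z => z == 0
  | j.+1 => fun z => `[< exists y : C j, cc_d C j y = val z >]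
  end.

Fact coboundary_subsemimod_closed : subsemimod_closed coboundary.
Proof.
rewrite /coboundary; case: i => [|j]; (split; first split).
- exact/eqP.
- by move=> x y /eqP-> /eqP->; apply/eqP; rewrite addr0.
- by move=> c x /eqP->; apply/eqP; rewrite scaler0.
- by apply/asboolP; exists 0; rewrite linear0.
- move=> x y /asboolP[u du] /asboolP[v dv]; apply/asboolP.
  by exists (u + v); rewrite linearD /= du dv.
- move=> c x /asboolP[u du]; apply/asboolP.
  by exists (c *: u); rewrite linearZ /= du.
Qed.

HB.instance Definition _ := GRing.isSubmodClosed.Build R
  (submod (cocycle C i)) coboundary coboundary_subsemimod_closed.

Definition cohomology : lmodType R := quotmod coboundary.

End CohomologyModule.

Section LocalCohomology.
Variable R : comNzRingType.

Definition injective_module (E : lmodType R) : Prop :=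
  forall (A B : lmodType R) (f : {linear A -> B}) (g : {linear A -> E}),
    injective f -> exists h : {linear B -> E}, forall x, h (f x) = g x.

Record injective_resolution (X : lmodType R) := InjectiveResolution {
  ir_complex :> cochain_complex R;
  ir_aug : {linear X -> ir_complex 0%N};
  ir_injective : forall i, injective_module (ir_complex i);
  ir_aug_inj : injective ir_aug;
  ir_exact0 : forall y, cc_d ir_complex 0 y = 0 <-> exists x, ir_aug x = y;
  ir_exactS : forall i y,
    cc_d ir_complex i.+1 y = 0 <-> exists x, cc_d ir_complex i x = y
}.

Variable I : submodClosed R^o.

Fact Gamma_complex_dd (C : cochain_complex R) i (x : Gamma I (C i)) :
  Gamma_map I (cc_d C i.+1) (Gamma_map I (cc_d C i) x) = 0.
Proof. by apply: val_inj; rewrite /= cc_dd. Qed.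

Definition Gamma_complex (C : cochain_complex R) : cochain_complex R :=
  @CochainComplex R (fun i => Gamma I (C i)) (fun i => Gamma_map I (cc_d C i))
    (Gamma_complex_dd (C := C)).

(* The right derived functor of Gamma is defined up to isomorphism: it is the
   cohomology of Gamma applied to an injective resolution. Every module has one
   (enough injectives), and any two are homotopy equivalent. *)
Definition local_cohomology (X : lmodType R) (E : injective_resolution X)
  (i : nat) : lmodType R := cohomology (Gamma_complex E) i.

End LocalCohomology.

(* Main.v *)
Require Import Defs.
From HB Require Import structures.
From mathcomp Require Import all_boot all_order all_algebra.
From mathcomp Require Import boolp functions.
From mathcomp Require classical_sets.

Set Implicit Arguments.
Unset Strict Implicit.
Unset Printing Implicit Defensive.

Import Order.TTheory GRing.Theory Num.Theory.
Local Open Scope ring_scope.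
Local Open Scope quotient_scope.

(** The implication from (ii) to (i) is the case i = 0, since H^0_a(X) is
    Gamma_a(X); it needs an injective resolution of M/N to exist, which comes
    from the embedding of any module into a product of copies of Hom(R, Q/Z).

    For the converse, let T/N be the torsion of M/N. The ZD property and prime
    avoidance give x in a that is regular on M/T ([ZD_regular_element]). The
    classical proof is an induction on i: replace M/N by M/T, use the exact
    sequence of multiplication by x on M/T to see the part of H^i_a killed by x
    as a quotient of H^(i-1)_a(M/(T + xM)), and conclude by Melkersson's
    criterion ([artinian_mod_power_torsion]), as H^i_a is x-power-torsion. All
    the modules met are quotients of M, for which the hypothesis holds.

    To run this on an arbitrary injective resolution E of M/N, without comparing
    resolutions of different modules, E is replaced by C = E/Gamma_a(E). Over a
    Noetherian ring Gamma_a of an injective is injective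
    ([torsion_injective]), so C consists of torsion-free injectives. Its
    cohomology is H^(i+1)_a(M/N) in degree i > 0, and in degree 0 it is a
    torsion-free module W into which M/T embeds with cokernel H^1_a(M/N). Passing
    to the quotient by x then means taking the mapping cone of x on C, which is
    again a complex of torsion-free injectives: it has no cohomology in degree 0,
    and in degree 1 it has a module containing M/(T + xM) up to torsion
    ([cone_transform_complex]). The step can thus be repeated, all the modules in
    play being described by a complex, a degree m and a map from M
    ([transform_complex]). That the cohomology in degree m stays torsion-free is
    where injectivity enters: below degree m the complex splits
    ([cobound_tors_closed]). The induction ends with H^1_a: the part of
    W/(M/T) killed by x is, through multiplication by x, a submodule of the
    torsion of M/(T + xM) ([cokernel_artinian]). *)

(** * Submodules as predicates, and Artinian subquotients *)

Section Submodules.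
Variables (R : pzRingType) (V : lmodType R).
Implicit Types P Q : V -> Prop.

(** The arguments form many submodules on the fly (images, preimages, sums,
    unions); as predicates they need no structure to be declared. *)
Definition submodule P : Prop :=
  P 0 /\ forall c u v, P u -> P v -> P (c *: u + v).

Lemma submodule0 P : submodule P -> P 0.
Proof. by case. Qed.

Lemma submoduleD P u v : submodule P -> P u -> P v -> P (u + v).
Proof. by move=> [_ PL] Pu Pv; rewrite -[u]scale1r; apply: PL. Qed.

Lemma submoduleZ P c u : submodule P -> P u -> P (c *: u).
Proof. by move=> [P0 PL] Pu; rewrite -[_ *: _]addr0; apply: PL. Qed.

Lemma submoduleB P u v : submodule P -> P u -> P v -> P (u - v).
Proof. by move=> [_ PL] Pu Pv; rewrite addrC -scaleN1r; apply: PL. Qed.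

Lemma linear_combB c (u u' v v' : V) :
  c *: u + u' - (c *: v + v') = c *: (u - v) + (u' - v').
Proof. by rewrite opprD addrACA -scalerBr. Qed.

Lemma submodule_mem (N : submodClosed V) : submodule (fun v => v \in N).
Proof. by split=> [|c u v uN vN]; rewrite ?rpred0 // rpredD ?rpredZ. Qed.

Lemma submodule_zero : submodule (fun v : V => v = 0).
Proof. by split=> // c u v -> ->; rewrite scaler0 addr0. Qed.

Section Bundle.
Variables (P : V -> Prop) (subP : submodule P).

Definition bundle_pred of submodule P : {pred V} := fun v => `[< P v >].

Fact bundle_closed : subsemimod_closed (bundle_pred subP).
Proof.
split; first split.
- by apply/asboolP; apply: submodule0.
- by move=> u v /asboolP Pu /asboolP Pv; apply/asboolP; apply: submoduleD.
- by move=> c u /asboolP Pu; apply/asboolP; apply: submoduleZ.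
Qed.

HB.instance Definition _ :=
  GRing.isSubmodClosed.Build R V (bundle_pred subP) bundle_closed.

Definition bundle : submodClosed V := bundle_pred subP.

Lemma mem_bundle v : v \in bundle <-> P v.
Proof. by split=> [/asboolP//|Pv]; apply/asboolP. Qed.
End Bundle.
End Submodules.

Section LinearBuild.
Variables (R : pzRingType) (U V : lmodType R) (f : U -> V) (lin_f : linear f).

Definition linear_of : {linear U -> V} :=
  HB.pack f (GRing.isLinear.Build R U V _ f lin_f).

End LinearBuild.

Section QuotientProjection.
Variables (R : pzRingType) (V : lmodType R) (N : submodClosed V).

Fact quot_proj_linear : linear (fun v : V => \pi_(quotmod N) v : quotmod N).
Proof.
by move=> c u v; rewrite quotmod_pi_add -quotmod_pi_scale.
Qed.

Definition quot_proj : {linear V -> quotmod N} := linear_of quot_proj_linear.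

Lemma quot_proj_eq0 v : quot_proj v = 0 <-> v \in N.
Proof.
rewrite -[0](linear0 quot_proj) -[v in v \in N]subr0.
by split=> [/eqP|vN]; [rewrite quotmod_eq | apply/eqP; rewrite quotmod_eq].
Qed.

Lemma quot_proj_surj (x : quotmod N) : exists v, quot_proj v = x.
Proof. by exists (repr x); apply: reprK. Qed.

End QuotientProjection.

Arguments quot_proj {R V} N : simpl never.

Section LinearRelations.
Variables (R : pzRingType) (U V : lmodType R).
Implicit Type rho : U -> V -> Prop.

(** Linear relations stand for the maps between subquotients of two modules:
    a class is related to another one through any choice of representatives,
    so that no quotient has to be formed and no choice has to be linear. *)
Definition linear_rel rho : Prop :=
  rho 0 0 /\ forall c u v u' v',
    rho u v -> rho u' v' -> rho (c *: u + u') (c *: v + v').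

Lemma linear_relB rho u v u' v' :
  linear_rel rho -> rho u v -> rho u' v' -> rho (u - u') (v - v').
Proof.
move=> [_ rhoL] uv uv'; rewrite ![_ - _]addrC -!scaleN1r.
exact: rhoL.
Qed.

Lemma linear_relZ rho c u v : linear_rel rho -> rho u v -> rho (c *: u) (c *: v).
Proof.
by move=> [rho0 rhoL] uv; rewrite -[c *: u]addr0 -[c *: v]addr0; apply: rhoL.
Qed.

End LinearRelations.

Section ArtinianSubquotients.
Variable R : pzRingType.

(** The descending chain condition on the subquotient P/Q of V, read off the
    submodules of V between Q and P. *)
Definition artinian_mod (V : lmodType R) (P Q : V -> Prop) : Prop :=
  forall C : nat -> V -> Prop,
    (forall n, submodule (C n)) ->
    (forall n v, Q v -> C n v) -> (forall n v, C n v -> P v) ->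
    (forall n v, C n.+1 v -> C n v) ->
    exists n, forall m v, (n <= m)%N -> C n v -> C m v.

Lemma descending_chain (T : Type) (C : nat -> T -> Prop) :
  (forall n v, C n.+1 v -> C n v) ->
  forall m n v, (n <= m)%N -> C m v -> C n v.
Proof.
move=> CS m n v; elim: m => [|m IHm]; first by rewrite leqn0 => /eqP->.
by rewrite leq_eqVlt => /predU1P[->//|/IHm Cm /CS/Cm].
Qed.

Lemma artinian_modP (V : lmodType R) :
  artinian V <-> artinian_mod (fun _ : V => True) (fun v => v = 0).
Proof.
split=> artV C.
  move=> subC _ _ CS; have [|n Cn] := artV (fun n => bundle (subC n)).
    by move=> n v /mem_bundle Cv; apply/mem_bundle; apply: CS.
  exists n => m v nm Cv; apply/(mem_bundle (subC m)).
  by rewrite (Cn m nm); apply/mem_bundle.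
move=> CS; have [|n _ ->|||n Cn] := artV (fun n v => v \in C n).
- by move=> n; apply: submodule_mem.
- exact: rpred0.
- by [].
- by move=> n v; apply: CS.
exists n => m nm v; apply/idP/idP; last exact: Cn.
exact: (@descending_chain _ (fun n v => v \in C n)).
Qed.

(** When [rho] is total on P and only relates P to Q' inside Q, it makes P/Q
    a quotient of a submodule of P'/Q'. A chain C is then recovered from the
    chain of its images enlarged by Q'. *)
Lemma artinian_mod_rel (U V : lmodType R) (P Q : U -> Prop) (P' Q' : V -> Prop)
    (rho : U -> V -> Prop) :
    linear_rel rho -> submodule P -> submodule P' -> submodule Q' ->
    (forall v, Q' v -> P' v) ->
    (forall u, P u -> exists2 v, P' v & rho u v) ->
    (forall u v, P u -> Q' v -> rho u v -> Q u) ->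
  artinian_mod P' Q' -> artinian_mod P Q.
Proof.
move=> lin_rho subP subP' subQ' sQP' rho_dom rho_ker artV C subC QC CP CS.
pose D n v := P' v /\ exists u q, [/\ C n u, Q' q & rho u (v - q)].
have [||||n Dn] := artV D.
- move=> n; split=> [|c v v' [P'v [u [q [Cu Qq r]]]] [P'v' [u' [q' [Cu' Qq' r']]]]].
    split; first exact: submodule0.
    exists 0, 0; rewrite subrr; split; [| |by case: lin_rho].
      exact: submodule0.
    exact: submodule0.
  split; first by case: subP' => _; apply.
  exists (c *: u + u'), (c *: q + q'); split.
  - by case: (subC n) => _; apply.
  - by case: subQ' => _; apply.
  by rewrite opprD addrACA -scalerBr; apply lin_rho.2.
- move=> n v Qv; split; first exact: sQP'.
  exists 0, v; rewrite subrr; split=> //; last by case: lin_rho.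
  exact: submodule0.
- by move=> n v [].
- by move=> m v [P'v [u [q [/CS Cu Qq r]]]]; split=> //; exists u, q.
exists n => m u nm Cu.
have [v P'v r] := rho_dom u (CP n u Cu).
have : D n v.
  split=> //; exists u, 0; rewrite subr0; split=> //.
  exact: submodule0.
move=> /(Dn m v nm) [_ [u' [q [Cu' Qq r']]]].
rewrite -(subrK u' u); apply: submoduleD => //; apply: QC.
have {r'}r' := linear_relB lin_rho r r'.
apply: rho_ker r' => //; last by rewrite opprB addrCA subrr addr0.
by apply: submoduleB => //; [apply: CP Cu | apply: CP Cu'].
Qed.

End ArtinianSubquotients.

Section PowerTorsion.
Variables (R : comNzRingType) (V : lmodType R).
Implicit Types P Q : V -> Prop.

Lemma submodule_scale P (x : R) :
  submodule P -> submodule (fun v => P (x *: v)).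
Proof.
move=> subP; split=> [|c u v Pu Pv]; first by rewrite scaler0; apply: submodule0.
by rewrite scalerDr scalerA mulrC -scalerA; case: subP => _; apply.
Qed.

Lemma submoduleI P Q : submodule P -> submodule Q -> submodule (fun v => P v /\ Q v).
Proof.
move=> [P0 PL] [Q0 QL]; split=> // c u v [Pu Qu] [Pv Qv].
by split; [apply: PL | apply: QL].
Qed.

(** Melkersson's criterion for one element: an x-power-torsion module whose
    x-annihilated part is Artinian is Artinian. A submodule N is determined by
    the submodules N_j = x^j N inter (0 : x), because these allow one to correct
    an element of (0 : x^(j+1)) by an element of N so as to land in (0 : x^j).
    For a descending chain C_i, the family (C_i)_j decreases in both indices
    inside the Artinian module (0 : x), so it becomes constant in i at a rank
    independent of j: the diagonal takes care of all large j at once. *)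
Lemma artinian_mod_power_torsion P Q (x : R) :
    submodule P -> submodule Q -> (forall v, Q v -> P v) ->
    (forall v, P v -> exists k, Q (x ^+ k *: v)) ->
    artinian_mod (fun v => P v /\ Q (x *: v)) Q ->
  artinian_mod P Q.
Proof.
move=> subP subQ sQP tors artK C subC QC CP CS.
(* the j-th layer of C i, modulo Q *)
pose D i j v := [/\ P v, Q (x *: v) & exists2 y, C i y & Q (v - x ^+ j *: y)].
have subD i j : submodule (D i j).
  split=> [|c u v [Pu Qu [y Cy Qy]] [Pv Qv [z Cz Qz]]]; first split.
  - exact: submodule0.
  - by rewrite scaler0; apply: submodule0.
  - by exists 0; rewrite ?scaler0 ?subr0; apply: submodule0.
  split.
  - by case: subP => _; apply.
  - by rewrite scalerDr scalerA mulrC -scalerA; case: subQ => _; apply.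
  exists (c *: y + z); first by case: (subC i) => _; apply.
  rewrite scalerDr opprD addrACA scalerA [_ * c]mulrC -scalerA -scalerBr.
  by case: subQ => _; apply.
have QD i j v : Q v -> D i j v.
  move=> Qv; split; [exact: sQP|exact: submoduleZ|].
  by exists 0; rewrite ?scaler0 ?subr0 //; apply: submodule0.
have DSi i j v : D i.+1 j v -> D i j v.
  by move=> [Pv Qv [y /CS Cy Qy]]; split=> //; exists y.
have DSj i j v : D i j.+1 v -> D i j v.
  move=> [Pv Qv [y Cy Qy]]; split=> //; exists (x *: y).
    exact: submoduleZ.
  by rewrite scalerA -exprSr.
have DPQ i j v : D i j v -> P v /\ Q (x *: v) by case.
have [n0 Dn0] := artK (fun i => D i i) (fun i => subD i i) (fun i => QD i i)
  (fun i => DPQ i i) (fun i v Dv => DSi _ _ _ (DSj _ _ _ Dv)).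
(* below the rank given by the diagonal only finitely many j remain *)
have [n1 Dn1] : exists n1, forall j, (j < n0)%N ->
    forall m v, (n1 <= m)%N -> D n1 j v -> D m j v.
  elim: n0 {Dn0} => [|k [n1 Dn1]]; first by exists 0%N.
  have [n2 Dn2] := artK (fun i => D i k) (fun i => subD i k) (fun i => QD i k)
    (fun i => DPQ i k) (fun i => DSi i k).
  exists (maxn n1 n2) => j; rewrite ltnS leq_eqVlt => jk m v.
  rewrite geq_max => /andP[n1m n2m] Dv.
  case/predU1P: jk Dv => [->|jk] Dv.
    apply: Dn2 => //.
    by apply: (descending_chain (DSi^~ k)) Dv; apply: leq_maxr.
  apply: Dn1 => //.
  by apply: (descending_chain (DSi^~ j)) Dv; apply: leq_maxl.
pose n := maxn n0 n1.
have Dn j m v : (n <= m)%N -> D n j v -> D m j v.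
  move=> nm Dv; have [jn0|n0j] := ltnP j n0.
    apply: Dn1 => //; first exact: leq_trans (leq_maxr _ _) nm.
    by apply: (descending_chain (DSi^~ j)) Dv; apply: leq_maxr.
  have Dv' : D n0 n0 v.
    apply: (descending_chain (DSi^~ n0)) (leq_maxl n0 n1) _.
    exact: (descending_chain (DSj n)) n0j Dv.
  have := Dn0 (maxn m j) v (leq_trans n0j (leq_maxr _ _)) Dv'.
  move=> /(descending_chain (DSj _) (leq_maxr m j)).
  exact: (descending_chain (DSi^~ j)) (leq_maxl _ _).
exists n => m v nm Cv; have [k] := tors v (CP _ _ Cv).
(* the power of x that sends v into Q decreases at each correction *)
elim: k v Cv => [|k IHk] v Cv Qv.
  by apply: QC; rewrite expr0 scale1r in Qv.
have [_ _ [y Cy Qy]] : D m k (x ^+ k *: v).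
  apply: Dn => //; split.
  - by apply: submoduleZ => //; apply: CP Cv.
  - by rewrite scalerA -exprS.
  by exists v => //; rewrite subrr; apply: submodule0.
rewrite -(subrK y v); apply: submoduleD => //; apply: IHk.
  apply: submoduleB => //; exact: (descending_chain CS) nm Cy.
by rewrite scalerBr.
Qed.

End PowerTorsion.

(** * Injectivity in terms of linear relations *)

Section Injectivity.
Variable R : comNzRingType.

Definition single_valued (U V : lmodType R) (rho : U -> V -> Prop) : Prop :=
  forall v, rho 0 v -> v = 0.

Lemma linear_rel_functional (U V : lmodType R) (rho : U -> V -> Prop) u v v' :
  linear_rel rho -> single_valued rho -> rho u v -> rho u v' -> v = v'.
Proof.
move=> lin_rho sv_rho uv uv'; apply/eqP; rewrite -subr_eq0; apply/eqP.
by apply: sv_rho; rewrite -(subrr u); apply: linear_relB.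
Qed.

Lemma linear_rel_fun (U V : lmodType R) (rho : U -> V -> Prop) :
    linear_rel rho -> single_valued rho -> (forall u, exists v, rho u v) ->
  exists f : {linear U -> V}, forall u v, rho u v -> f u = v.
Proof.
move=> lin_rho sv_rho /choice[f rho_f].
have f_unique u v : rho u v -> f u = v.
  exact: linear_rel_functional lin_rho sv_rho (rho_f u).
have lin_f : linear f by move=> c u v; apply: f_unique; apply lin_rho.2.
by exists (linear_of lin_f).
Qed.

(** Extension of partial linear maps, given by their graphs. A graph replaces
    both a submodule of B and a map on it, which suits Zorn's lemma as well as
    the extension problems met below, where maps come as correspondences. *)
Definition injective_rel (E : lmodType R) : Prop :=
  forall (B : lmodType R) (phi : B -> E -> Prop),
    linear_rel phi -> single_valued phi ->
    exists h : {linear B -> E}, forall b e, phi b e -> h b = e.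

Definition Baer_condition (E : lmodType R) : Prop :=
  forall phi : R^o -> E -> Prop, linear_rel phi -> single_valued phi ->
    exists y : E, forall (r : R) e, phi r e -> e = r *: y.

Lemma injective_module_rel (E : lmodType R) :
  injective_module E -> injective_rel E.
Proof.
move=> injE B phi lin_phi sv_phi.
have dom_sub : submodule (fun b => exists e, phi b e).
  split=> [|c b b' [e be] [e' be']]; first by exists 0; case: lin_phi.
  by exists (c *: e + e'); apply lin_phi.2.
pose A := submod (bundle dom_sub).
have [||u|g phi_g] := @linear_rel_fun A E (fun u e => phi (val u) e).
- split=> [|c u v u' v' uv uv']; rewrite ?linear0 ?linearP; first by case: lin_phi.
  exact: lin_phi.2.
- by move=> v; rewrite linear0; apply: sv_phi.
- exact/(mem_bundle dom_sub)/(valP u).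
have [h hg] := injE A B (val : {linear A -> B}) g val_inj.
exists h => b e be.
have bdom : b \in bundle dom_sub by apply/mem_bundle; exists e.
by rewrite -[b](SubK A bdom) hg; apply: phi_g; rewrite SubK.
Qed.

(** Baer's criterion. A maximal single-valued extension psi of the given graph
    is total: for b in B, the ideal of the r such that psi is defined at r b
    carries a partial map to E, which is multiplication by some y, and psi
    extends by b |-> y. *)
Lemma Baer_injective_rel (E : lmodType R) : Baer_condition E -> injective_rel E.
Proof.
move=> baerE B phi lin_phi sv_phi.
pose extends (psi : B -> E -> Prop) :=
  [/\ linear_rel psi, single_valued psi & forall b e, phi b e -> psi b e].
pose le (s t : {psi | extends psi}) : bool :=
  `[< forall b e, sval s b e -> sval t b e >].
have phi_ext : extends phi by split.
have [||A totA|[psi [lin_psi sv_psi phi_psi]] psi_max] :=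
    @classical_sets.ZL_preorder _ (exist _ _ phi_ext : {psi | extends psi}) le.
- by move=> s; apply/asboolP.
- by move=> r s t /asboolP rs /asboolP st; apply/asboolP => b e /rs/st.
(* the empty chain is bounded by phi, a nonempty one by its union *)
- have [A0|/existsNP[s0 /contrapT As0]] := EM (forall s, ~ A s).
    by exists (exist _ _ phi_ext) => s /A0.
  pose psi b e := exists2 s, A s & sval s b e.
  have psi2 b e b' e' : psi b e -> psi b' e' ->
      exists s, [/\ A s, sval s b e & sval s b' e'].
    move=> [s As be] [s' As' be'].
    by case: (totA s s' As As') => /asboolP ss'; [exists s' | exists s];
      split=> //; apply: ss'.
  have psi_ext : extends psi.
    split=> [|e [s _ e0]|b e be].
    - split=> [|c u v u' v' uv uv'].
        by exists s0 => //; case: (svalP s0) => -[].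
      have [s [As suv suv']] := psi2 _ _ _ _ uv uv'.
      by exists s => //; case: (svalP s) => -[_ sL] _ _; apply: sL.
    - by case: (svalP s) => _ /(_ e e0).
    - by exists s0 => //; case: (svalP s0) => _ _; apply.
  exists (exist _ _ psi_ext) => s As; apply/asboolP => b e be.
  by exists s.
suff tot b : exists e, psi b e.
  have [h hP] := linear_rel_fun lin_psi sv_psi tot.
  by exists h => b e /phi_psi/hP.
have [||y yP] := baerE (fun r e => psi ((r : R) *: b) e).
- split=> [|c r e r' e' re re']; first by rewrite scale0r; apply lin_psi.1.
  by rewrite scalerDl -scalerA; apply lin_psi.2.
- by move=> e; rewrite scale0r; apply: sv_psi.
pose psi' u e := exists r : R, psi (u - r *: b) (e - r *: y).
have psi_psi' u e : psi u e -> psi' u e.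
  by move=> ue; exists 0; rewrite !scale0r !subr0.
have psi'_ext : extends psi'.
  split=> [|e [r]|u e /phi_psi/psi_psi'//].
  - split=> [|c u e u' e' [r re] [r' re']]; first by apply: psi_psi'; apply lin_psi.1.
    exists (c * r + r').
    by rewrite !scalerDl -!scalerA !linear_combB; apply lin_psi.2.
  - rewrite sub0r -scaleNr => /yP/eqP.
    by rewrite scaleNr subr_eq addNr => /eqP.
exists y; have /asboolP := psi_max (exist _ _ psi'_ext) (asboolT psi_psi').
by apply; exists 1; rewrite !scale1r !subrr; apply lin_psi.1.
Qed.

Lemma injective_rel_Baer (E : lmodType R) : injective_rel E -> Baer_condition E.
Proof.
move=> injE phi lin_phi sv_phi; have [h hP] := injE _ phi lin_phi sv_phi.
exists (h (1 : R^o)) => r e re; rewrite -linearZ /=.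
by rewrite -(hP r e re) /GRing.scale /= mulr1.
Qed.

Lemma injective_rel_prod (E F : lmodType R) :
  injective_rel E -> injective_rel F -> injective_rel (E * F)%type.
Proof.
move=> injE injF B phi lin_phi sv_phi.
have [||h hP] := injE B (fun b e => exists f, phi b (e, f)).
- split=> [|c b e b' e' [f bf] [f' bf']]; first by exists 0; case: lin_phi.
  by exists (c *: f + f'); apply: (lin_phi.2 c _ _ _ _ bf bf').
- by move=> e [f /sv_phi[]].
have [||k kP] := injF B (fun b f => exists e, phi b (e, f)).
- split=> [|c b e b' e' [f bf] [f' bf']]; first by exists 0; case: lin_phi.
  by exists (c *: f + f'); apply: (lin_phi.2 c _ _ _ _ bf bf').
- by move=> f [e /sv_phi[]].
have lin_hk : linear (fun b => (h b, k b)) by move=> c b b'; rewrite !linearP.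
exists (linear_of lin_hk) => b [e f] bef /=.
by rewrite (hP b e) ?(kP b f) //; [exists e | exists f].
Qed.

End Injectivity.

(** * Enough injectives *)

Section RatModInt.

Fact int_submodule :
  submodule (fun q : zmodule rat => exists n : int, q = n%:~R :> rat).
Proof.
split=> [|c u v [m ->] [n ->]]; first by exists 0.
by exists (m * c + n); rewrite rmorphD rmorphM /= mulrzr.
Qed.

(** The group Q/Z, as a module over the integers. *)
Definition rat_mod_int : lmodType int := quotmod (bundle int_submodule).

Definition rat_class (q : rat) : rat_mod_int :=
  \pi_(quotmod (bundle int_submodule)) (q : zmodule rat).

Lemma rat_class_scale (k : int) (q : rat) :
  k *: rat_class q = rat_class (k%:~R * q).
Proof. by rewrite [LHS]quotmod_pi_scale mulrzl. Qed.

Lemma rat_class_eq0 (q : rat) :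
  rat_class q = 0 <-> exists n : int, q = n%:~R.
Proof.
have -> : 0 = rat_class 0 by rewrite -[LHS](scale0r (rat_class 0)) rat_class_scale mul0r.
split=> [/eqP|qZ].
  by rewrite quotmod_eq subr0 => /mem_bundle.
by apply/eqP; rewrite quotmod_eq subr0; apply/mem_bundle.
Qed.

Lemma rat_mod_int_divisible (k : int) (e : rat_mod_int) :
  k != 0 -> exists y, k *: y = e.
Proof.
move=> k0; exists (rat_class ((repr e : rat) / k%:~R)).
rewrite rat_class_scale mulrCA divff ?intr_eq0 // mulr1.
exact: reprK.
Qed.

(** An ideal of the integers is generated by its least positive element n, if
    it has any, so a partial map is determined by the image of n, and Q/Z is
    divisible. *)
Lemma Baer_rat_mod_int : Baer_condition rat_mod_int.
Proof.
move=> phi lin_phi sv_phi.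
have [[k k0 [e0 ke0]]|dom0] :=
    EM (exists2 k : int, k != 0 & exists e, phi k e); last first.
  exists 0 => r e re; rewrite scaler0.
  have [r0|r0] := eqVneq r 0; first by apply: sv_phi; rewrite -r0.
  by case: dom0; exists r => //; exists e.
have pos : exists n : nat, (0 < n)%N && `[< exists e, phi n%:Z e >].
  exists `|k|%N; rewrite absz_gt0 k0; apply/asboolP.
  exists (sgz k *: e0); have := linear_relZ (sgz k) lin_phi ke0.
  by rewrite /GRing.scale /= -abszEsg.
case: (ex_minnP pos) => n /andP[n0 /asboolP[e ne]] min_n.
have [|y ye] := rat_mod_int_divisible (k := n%:Z) e; first by rewrite -lt0n.
exists y => l e' le'; have {le'} := linear_relB lin_phi le' (linear_relZ (l %/ n)%Z lin_phi ne).
have -> : l - (l %/ n)%Z *: (n%:Z : int^o) = (l %% n)%Z.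
  by rewrite [X in X - _](divz_eq l n) addrC addKr.
have r_ge0 : 0 <= (l %% n)%Z by rewrite modz_ge0 // -lt0n.
have r_lt : ((l %% n)%Z < n%:Z) by rewrite ltz_pmod.
rewrite -(gez0_abs r_ge0) => le'.
have r0 : (l %% n)%Z = 0.
  apply/eqP; rewrite -absz_eq0; apply: contraTT r_lt => r0.
  rewrite -leNgt -(gez0_abs r_ge0) lez_nat; apply: min_n.
  by rewrite lt0n r0; apply/asboolP; exists (e' - (l %/ n)%Z *: e).
rewrite r0 in le'; move/sv_phi/eqP: le'; rewrite subr_eq0 => /eqP->.
by rewrite -ye scalerA [l in RHS](divz_eq l n) r0 addr0.
Qed.

(** The cyclic group generated by b has a quotient of some order n > 1; send b
    to the class of 1/n and extend. An element of infinite order is treated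
    with n = 2. *)
Lemma rat_mod_int_cogenerator (B : lmodType int) (b : B) :
  b != 0 -> exists phi : {linear B -> rat_mod_int}, phi b != 0.
Proof.
move=> b0; have [n n_gt1 n_ann] : exists2 n : nat, (1 < n)%N &
    forall k : int, k *: b = 0 -> exists q, k = q * n%:Z.
  have [[k k0 kb]|ann0] := EM (exists2 k : int, k != 0 & k *: b = 0); last first.
    exists 2%N => // k kb; exists 0; rewrite mul0r; apply/eqP.
    by apply: contrapT => /negP k0; apply: ann0; exists k.
  have pos : exists n : nat, (0 < n)%N && (n%:Z *: b == 0).
    by exists `|k|%N; rewrite absz_gt0 k0 abszEsg -scalerA kb scaler0 eqxx.
  case: (ex_minnP pos) => n /andP[n0 /eqP nb] min_n; exists n.
    rewrite ltn_neqAle n0 andbT; apply/eqP => n1.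
    by rewrite -n1 scale1r in nb; rewrite nb eqxx in b0.
  move=> l lb; exists (l %/ n)%Z.
  have r_ge0 : 0 <= (l %% n)%Z by rewrite modz_ge0 // -lt0n.
  have r_lt : ((l %% n)%Z < n%:Z) by rewrite ltz_pmod.
  have rb : (l %% n)%Z *: b = 0.
    move: lb; rewrite {1}(divz_eq l n) scalerDl -scalerA nb scaler0 add0r.
    by [].
  have r0 : (l %% n)%Z = 0.
    apply/eqP; rewrite -absz_eq0; apply: contraTT r_lt => r0.
    rewrite -leNgt -(gez0_abs r_ge0) lez_nat; apply: min_n.
    by rewrite lt0n r0 gez0_abs // rb eqxx.
  by rewrite {1}(divz_eq l n) r0 addr0.
pose t := rat_class (n%:R^-1).
have n0 : n%:R != 0 :> rat by rewrite pnatr_eq0 -lt0n ltnW.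
have [||h hP] := Baer_injective_rel Baer_rat_mod_int
    (phi := fun u e => exists2 k : int, k *: b = u & k *: t = e).
- split=> [|c u e u' e' [k <- <-] [k' <- <-]]; first by exists 0; rewrite scale0r.
  by exists (c * k + k'); rewrite scalerDl scalerA.
- move=> e [k /n_ann[q ->] <-]; rewrite rat_class_scale; apply/rat_class_eq0.
  by exists q; rewrite intrM mulfK.
exists h; rewrite (hP b t); last by exists 1; rewrite scale1r.
apply/eqP => /rat_class_eq0[k nk].
have n_pos : 0 < n%:R :> rat by rewrite ltr0n ltnW.
have : 0 < (k%:~R : rat) < 1.
  by rewrite -nk invr_gt0 n_pos invf_lt1 // ltr1n.
by rewrite ltr0z ltrz1 gtz0_ge1 leNgt => /andP[/negPf->].
Qed.

End RatModInt.

Section Cofree.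
Variables (R : comNzRingType) (I : Type) (D : zmodType).

(** The product over I of the groups of additive maps from R to D, with R
    acting by translation of the argument: the cofree modules. *)
Definition cofree_pred : {pred I -> R -> D} :=
  fun F => `[< forall i r s, F i (r + s) = F i r + F i s >].

Fact cofree_zmod_closed : zmod_closed cofree_pred.
Proof.
split=> [|F G /asboolP FD /asboolP GD]; apply/asboolP => i r s.
  by rewrite addr0.
by rewrite !fctE FD GD opprD addrACA.
Qed.

HB.instance Definition _ :=
  GRing.isZmodClosed.Build (I -> R -> D) cofree_pred cofree_zmod_closed.

Record cofree := Cofree { cofree_val :> I -> R -> D; _ : cofree_val \in cofree_pred }.
HB.instance Definition _ := [isSub for cofree_val].
HB.instance Definition _ := [Choice of cofree by <:].
HB.instance Definition _ := [SubChoice_isSubZmodule of cofree by <:].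

Lemma cofreeD (F : cofree) i r s : F i (r + s) = F i r + F i s.
Proof. by case: F => F /= /asboolP. Qed.

Fact cofree_scale_subproof (c : R) (F : cofree) :
  (fun i r => F i (r * c)) \in cofree_pred.
Proof. by apply/asboolP => i r s; rewrite mulrDl cofreeD. Qed.

Definition cofree_scale c F : cofree := Cofree (cofree_scale_subproof c F).

Lemma cofreeP (F G : cofree) : (forall i r, F i r = G i r) -> F = G.
Proof. by move=> FG; apply: val_inj; apply/funext => i; apply/funext => r; apply: FG. Qed.

Fact cofree_scaleA c d F : cofree_scale c (cofree_scale d F) = cofree_scale (c * d) F.
Proof. by apply: cofreeP => i r /=; rewrite mulrA. Qed.

Fact cofree_scale1 : left_id 1 cofree_scale.
Proof. by move=> F; apply: cofreeP => i r /=; rewrite mulr1. Qed.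

Fact cofree_scaleDr : right_distributive cofree_scale +%R.
Proof. by move=> c F G; apply: cofreeP. Qed.

Fact cofree_scaleDl F : {morph cofree_scale^~ F : c d / c + d}.
Proof. by move=> c d; apply: cofreeP => i r /=; rewrite mulrDr cofreeD. Qed.

HB.instance Definition _ := GRing.Zmodule_isLmodule.Build R cofree
  cofree_scaleA cofree_scale1 cofree_scaleDr cofree_scaleDl.

Lemma cofreeE (c : R) (F G : cofree) i r : (c *: F + G) i r = F i (r * c) + G i r.
Proof. by []. Qed.

End Cofree.

Section EnoughInjectives.
Variable R : comNzRingType.

Lemma int_scale (V : lmodType int) (c : int) (v : V) : c *: v = v *~ c.
Proof. by rewrite -[c in LHS]intz scaler_int. Qed.

Lemma additive_intM (U V : zmodType) (k : U -> V) (c : int) u :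
  {morph k : x y / x + y} -> k (u *~ c) = k u *~ c.
Proof.
move=> kD.
have kB : zmod_morphism k.
  by move=> x y; apply: (addIr (k y)); rewrite -kD !subrK.
pose k' : {additive U -> V} := HB.pack k (GRing.isZmodMorphism.Build U V k kB).
by have := raddfMz k' c u.
Qed.

(** By adjunction an R-linear map to a cofree module is a family of additive
    maps to D, so the injectivity of D over the integers passes on. *)
Lemma cofree_injective (I : Type) (D : lmodType int) :
  injective_rel D -> injective_module (cofree R I D).
Proof.
move=> injD A B f g f_inj.
have ext i : exists h : zmodule B -> D,
    {morph h : x y / x + y} /\ forall a, h (f a) = g a i 1.
  have gD : {morph (fun a => g a i 1) : x y / x + y}.
    by move=> x y; rewrite linearD.
  have [||h hP] := injD (zmodule B) (fun b e => exists2 a, f a = b & g a i 1 = e).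
  - split=> [|c u e u' e' [a <- <-] [a' <- <-]]; first by exists 0; rewrite linear0.
    exists (a *~ c + a'); first by rewrite linearD raddfMz.
    by rewrite int_scale [LHS]gD (additive_intM c a gD).
  - move=> e [a fa0 <-]; rewrite (_ : a = 0) ?linear0 //.
    by apply: f_inj; rewrite linear0.
  exists h; split=> [x y|a]; first exact: linearD.
  by apply: hP; exists a.
have [h hP] := choice ext.
have H_mem b : (fun i (r : R) => h i (r *: b)) \in @cofree_pred R I D.
  by apply/asboolP => i r s; rewrite scalerDl (hP i).1.
have H_lin : linear (fun b => Cofree (H_mem b)).
  move=> c b b'; apply: cofreeP => i r.
  by rewrite cofreeE /= scalerDr (hP i).1 scalerA.
exists (linear_of H_lin) => a; apply: cofreeP => i r /=.
by rewrite -linearZ (hP i).2 linearZ /= mul1r.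
Qed.

(** Indexing the copies of Q/Z by the elements of X itself suffices: the
    component of index x is an additive map that does not kill x. *)
Lemma enough_injectives (X : lmodType R) :
  exists (E : lmodType R) (j : {linear X -> E}), injective_module E /\ injective j.
Proof.
have sep (x : X) : exists phi : {linear zmodule X -> rat_mod_int},
    x != 0 -> phi x != 0.
  have [->|x0] := eqVneq x 0.
    by exists \0.
  by have [phi phix] := @rat_mod_int_cogenerator (zmodule X) x x0; exists phi.
have [phi phiP] := choice sep.
have j_mem x : (fun i (r : R) => phi i (r *: x)) \in @cofree_pred R X rat_mod_int.
  by apply/asboolP => i r s; rewrite scalerDl linearD.
have j_lin : linear (fun x => Cofree (j_mem x)).
  move=> c x y; apply: cofreeP => i r.
  by rewrite cofreeE /= scalerDr linearD scalerA.
exists (cofree R X rat_mod_int), (linear_of j_lin).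
split; first exact/cofree_injective/Baer_injective_rel/Baer_rat_mod_int.
apply: raddf_inj => x jx; apply/eqP; apply: contraT => /phiP/eqP; case.
by have := congr1 (fun F : cofree R X rat_mod_int => F x 1) jx; rewrite /= scale1r.
Qed.
End EnoughInjectives.

Section InjectiveResolutions.
Variable R : comNzRingType.

Section Hull.
Variable X : lmodType R.

Definition inj_hull : lmodType R := projT1 (cid (enough_injectives X)).

Definition inj_emb : {linear X -> inj_hull} :=
  projT1 (cid (projT2 (cid (enough_injectives X)))).

Lemma inj_hullP : injective_module inj_hull /\ injective inj_emb.
Proof. exact: projT2 (cid (projT2 (cid (enough_injectives X)))). Qed.

Fact inj_emb_image : submodule (fun e => exists x, inj_emb x = e).
Proof.
split=> [|c u v [x <-] [y <-]]; first by exists 0; rewrite linear0.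
by exists (c *: x + y); rewrite linearP.
Qed.

Definition cosyzygy : lmodType R := quotmod (bundle inj_emb_image).

Definition cosyzygy_proj : {linear inj_hull -> cosyzygy} := quot_proj _.

Lemma cosyzygy_proj_eq0 e : cosyzygy_proj e = 0 <-> exists x, inj_emb x = e.
Proof. exact: iff_trans (quot_proj_eq0 _ _) (mem_bundle inj_emb_image e). Qed.

End Hull.

Variable X : lmodType R.

Fixpoint syzygy i : lmodType R := if i is k.+1 then cosyzygy (syzygy k) else X.

Definition syzygy_d i : {linear inj_hull (syzygy i) -> inj_hull (syzygy i.+1)} :=
  @inj_emb (syzygy i.+1) \o @cosyzygy_proj (syzygy i).

Lemma syzygy_d_eq0 i e : syzygy_d i e = 0 <-> exists x, inj_emb (syzygy i) x = e.
Proof.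
have -> : syzygy_d i e = inj_emb (syzygy i.+1) (cosyzygy_proj (syzygy i) e) by [].
rewrite -cosyzygy_proj_eq0; split=> [|e0]; last by rewrite [X in inj_emb _ X]e0 linear0.
rewrite -[0 in X in X -> _](linear0 (inj_emb (syzygy i.+1))).
exact: (inj_hullP (syzygy i.+1)).2.
Qed.

Lemma syzygy_dd i e : syzygy_d i.+1 (syzygy_d i e) = 0.
Proof. by apply/syzygy_d_eq0; exists (cosyzygy_proj (syzygy i) e). Qed.

Lemma syzygy_exactS i e :
  syzygy_d i.+1 e = 0 <-> exists e', syzygy_d i e' = e.
Proof.
split=> [/syzygy_d_eq0[x <-]|[e' <-]]; last exact: syzygy_dd.
by have [e' <-] := quot_proj_surj x; exists e'.
Qed.

Lemma injective_resolution_exists : inhabited (injective_resolution X).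
Proof.
constructor; exact (@InjectiveResolution R X (CochainComplex syzygy_dd)
  (inj_emb X) (fun i => (inj_hullP (syzygy i)).1) (inj_hullP X).2
  (@syzygy_d_eq0 0%N) syzygy_exactS).
Qed.

End InjectiveResolutions.

(** * Ideals of a Noetherian ring and power torsion *)

Section NoetherianRing.
Variable R : comNzRingType.
Implicit Types (J : R^o -> Prop) (a : submodClosed R^o).

(** Ascending chain condition to maximum condition, by dependent choice. *)
Lemma noetherian_maximal (F : (R^o -> Prop) -> Prop) J0 :
    noetherian R^o -> submodule J0 -> F J0 ->
  exists J, [/\ submodule J, F J &
    forall J', submodule J' -> F J' -> (forall r, J r -> J' r) ->
      forall r, J' r -> J r].
Proof.
move=> noethR subJ0 FJ0; apply: contrapT => no_max.
pose T := {J | submodule J /\ F J}.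
have next (s : T) : exists t : T,
    (forall r, sval s r -> sval t r) /\ exists r, sval t r /\ ~ sval s r.
  case: s => J [subJ FJ] /=; apply: contrapT => J_max; apply: no_max.
  exists J; split=> // J' subJ' FJ' JJ' r J'r; apply: contrapT => nJr.
  by apply: J_max; exists (exist _ J' (conj subJ' FJ')); split=> //; exists r.
have [f fP] := choice next.
pose C n : T := iter n f (exist _ J0 (conj subJ0 FJ0)).
have [n r|n Cn] := noethR (fun n => bundle (svalP (C n)).1).
  by move=> /mem_bundle Cr; apply/mem_bundle; apply: (fP (C n)).1.
have [r [CSr nCr]] := (fP (C n)).2; apply: nCr.
apply/(mem_bundle (svalP (C n)).1); rewrite -(Cn n.+1) //.
exact/(mem_bundle (svalP (C n.+1)).1).
Qed.

Lemma mem_idealX (I : {pred R}) n r : r \in I -> r ^+ n \in idealX I n.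
Proof.
move=> Ir; elim: n => // n IHn; apply/asboolP.
exists [:: (r, r ^+ n)]; rewrite big_seq1 exprS; split=> // p.
by rewrite inE => /eqP->.
Qed.

Lemma ideal_colon J (x : R) :
  submodule J -> submodule (fun r : R^o => J (x * r : R)).
Proof. exact: submodule_scale. Qed.

Lemma idealX_addn (I : {pred R}) m n J :
    submodule J ->
    (forall u v : R, u \in idealX I m -> v \in idealX I n -> J (u * v : R)) ->
  forall r : R, r \in idealX I (m + n) -> J r.
Proof.
elim: m J => [|m IHm] J subJ mul_J r.
  by rewrite add0n => rIn; rewrite -[r]mul1r; apply: mul_J.
rewrite addSn => /asboolP[s [s_mem ->]].
rewrite big_seq; apply: (big_ind (fun r : R => J r)).
- exact: (submodule0 subJ).
- by move=> u v Ju Jv; apply: (submoduleD subJ Ju Jv).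
move=> p /s_mem[p1I p2I].
apply: (IHm (fun r => J (p.1 * r : R))) p2I; first exact: ideal_colon.
move=> u v uI vI; rewrite mulrA; apply: mul_J => //.
apply/asboolP; exists [:: (p.1, u)]; rewrite big_seq1; split=> // q.
by rewrite inE => /eqP->.
Qed.

(** If some power of each element of a lies in J, then a power of a does. Take
    J maximal among the counterexamples, r in a outside J, and s the last power
    of r outside J. Then (J : s) contains r and J + (s) contains s, so both
    contain powers of a, and the product of these two powers lies in
    (J : s) (J + (s)), hence in J. *)
Lemma idealX_sub_of_radical a J :
    noetherian R^o -> submodule J ->
    (forall r : R, r \in a -> exists k, J (r ^+ k : R)) ->
  exists m, forall r : R, r \in idealX (a : {pred R}) m -> J r.
Proof.
move=> noethR subJ radJ; apply: contrapT => no_m.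
pose F J := (forall r : R, r \in a -> exists k, J (r ^+ k : R)) /\
  ~ exists m, forall r : R, r \in idealX (a : {pred R}) m -> J r.
have [{radJ no_m subJ}J [subJ [radJ no_m] J_max]] :=
  @noetherian_maximal F J noethR subJ (conj radJ no_m).
have bigger J' : submodule J' -> (forall r, J r -> J' r) ->
    (exists r, J' r /\ ~ J r) ->
    exists m, forall r : R, r \in idealX (a : {pred R}) m -> J' r.
  move=> subJ' JJ' [r [J'r nJr]]; apply: contrapT => no_m'; apply: nJr.
  apply: J_max J'r => //; split=> // s /radJ[k Jk].
  by exists k; apply: JJ'.
have [r ra nJr] : exists2 r : R, r \in a & ~ J r.
  apply: contrapT => aJ; apply: no_m; exists 1%N => r /asboolP[s [s_mem ->]].
  rewrite big_seq; apply: (big_ind (fun r : R => J r)).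
  - exact: (submodule0 subJ).
  - by move=> u v Ju Jv; apply: (submoduleD subJ Ju Jv).
  move=> p /s_mem[p1 _]; rewrite mulrC; apply: (submoduleZ (p.2) subJ).
  by apply: contrapT => nJp; apply: aJ; exists p.1.
have rad_r : exists k, `[< J (r ^+ k : R) >].
  by have [k Jk] := radJ r ra; exists k; apply/asboolP.
case: (ex_minnP rad_r) => -[|k] /asboolP Jk min_k.
  by apply: nJr; rewrite -[r]mulr1; apply: (submoduleZ r subJ).
have nJk : ~ J (r ^+ k : R).
  by move=> Jk'; have := min_k k (asboolT Jk'); rewrite ltnn.
have [|||m1 m1P] := bigger (fun t : R^o => J (r ^+ k * t : R)).
- exact: ideal_colon.
- by move=> t Jt; apply: (submoduleZ (r ^+ k) subJ).
- by exists r; rewrite -exprSr.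
have [|||m2 m2P] := bigger (fun t => exists j c : R, J j /\ t = j + c * r ^+ k).
- split=> [|c t t' [j [d [Jj ->]]] [j' [d' [Jj' ->]]]].
    by exists 0, 0; rewrite mul0r addr0; split=> //; exact: (submodule0 subJ).
  exists (c * j + j'), (c * d + d'); split; first exact: (subJ.2 c j j').
  by rewrite /GRing.scale /= mulrDr mulrDl -mulrA addrACA.
- by move=> t Jt; exists t, 0; rewrite mul0r addr0.
- exists (r ^+ k); split=> //; exists 0, 1; rewrite mul1r add0r; split=> //.
  exact: (submodule0 subJ).
apply: no_m; exists (m1 + m2)%N; apply: idealX_addn => // u v /m1P Ju /m2P.
move=> [j [c [Jj ->]]]; rewrite mulrDr; apply: (submoduleD subJ).
  exact: (submoduleZ u subJ).
by rewrite mulrCA [u * _]mulrC; apply: (submoduleZ c subJ).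
Qed.

End NoetherianRing.

Section PowerTorsionElements.
Variables (R : comNzRingType) (a : submodClosed R^o).

(** Elements that are a-torsion modulo P, tested one element of a at a time.
    Over a Noetherian ring this agrees with being killed by a power of a (see
    [torsionP]); in this form the closure under extensions ([tors_idem]) is
    immediate. *)
Definition tors (V : lmodType R) (P : V -> Prop) (v : V) : Prop :=
  forall r : R, r \in a -> exists k, P (r ^+ k *: v).

Section Closure.
Variable V : lmodType R.
Implicit Types P Q : V -> Prop.

Lemma power_mem P (x : R) k l v :
  submodule P -> (k <= l)%N -> P (x ^+ k *: v) -> P (x ^+ l *: v).
Proof.
move=> subP /subnK <- Pv; rewrite exprD -scalerA.
exact: submoduleZ.
Qed.

Lemma tors_submodule P : submodule P -> submodule (tors P).
Proof.
move=> subP; split=> [r ra|c u v Pu Pv r ra].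
  by exists 0%N; rewrite scaler0; apply: submodule0.
have [k Pk] := Pu r ra; have [l Pl] := Pv r ra.
exists (maxn k l); rewrite scalerDr scalerA mulrC -scalerA.
apply subP.2; first exact: power_mem (leq_maxl k l) Pk.
exact: power_mem (leq_maxr k l) Pl.
Qed.

Lemma mem_tors P v : P v -> tors P v.
Proof. by move=> Pv r ra; exists 0%N; rewrite scale1r. Qed.

Lemma tors_idem P v : tors (tors P) v -> tors P v.
Proof.
move=> ttv r ra; have [k tv] := ttv r ra; have [l Pv] := tv r ra.
by exists (l + k)%N; rewrite exprD -scalerA.
Qed.

Hypothesis noethR : noetherian R^o.

Lemma torsionP v : v \in torsion a V <-> tors (fun u => u = 0) v.
Proof.
split=> [/asboolP[n nv] r ra|tv].
  by exists n; apply: nv; apply: mem_idealX.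
apply/asboolP.
apply: (@idealX_sub_of_radical _ a (fun r : R^o => (r : R) *: v = 0)) => //.
split=> [|c r s rv sv]; first by rewrite scale0r.
by rewrite scalerDl -scalerA rv sv scaler0 addr0.
Qed.

End Closure.
End PowerTorsionElements.

Section TorsionOfInjective.
Variables (R : comNzRingType) (a : submodClosed R^o).
Hypothesis noethR : noetherian R^o.

(** This does the work of the Artin-Rees lemma. If J inter I kills y, then the
    map r |-> r y on I extends to I + J by zero on J, hence it is also the
    multiplication by an element that J kills. Let J be maximal with this
    property; it contains the annihilator of y in I. For x in a the ideals
    (J : x^n) stabilise, say at k. If j + x^k r lies in I, then some x^n kills
    (j + x^k r) y, so x^n (j + x^k r) is in J, so x^k r is in J; hence
    J + (x^k) still has the property and x^k is in J. So J contains a power of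
    a, and the new element is a-torsion. *)
Lemma torsion_representative (E : lmodType R) (I : R^o -> Prop) (y : E) :
    injective_rel E -> submodule I ->
    (forall r : R, I r -> r *: y \in torsion a E) ->
  exists2 y', y' \in torsion a E & forall r : R, I r -> r *: y' = r *: y.
Proof.
move=> injE subI Iy.
pose F (J : R^o -> Prop) := forall r : R, J r -> I r -> r *: y = 0.
have [|r ->|J [subJ FJ J_max]] :=
    @noetherian_maximal R F (fun r : R^o => r = 0) noethR.
- exact: submodule_zero.
- by rewrite scale0r.
have J_max' (J' : R^o -> Prop) : submodule J' -> (forall r, J r -> J' r) ->
  F J' -> forall r, J' r -> J r by move=> subJ' JJ' FJ'; apply: J_max.
have ann_sub (r : R) : I r -> r *: y = 0 -> J r.
  move=> Ir ry0.
  apply: (J_max' (fun t : R^o => exists j k : R, [/\ J j, I k, k *: y = 0 & t = j + k])).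
  - split=> [|c t t' [j [k [Jj Ik ky ->]]] [j' [k' [Jj' Ik' ky' ->]]]].
      by exists 0, 0; rewrite scale0r addr0; split=> //; [exact: (submodule0 subJ)|exact: (submodule0 subI)].
    exists (c * j + j'), (c * k + k'); split.
    + exact: (subJ.2 c j j').
    + exact: (subI.2 c k k').
    + by rewrite scalerDl -scalerA ky ky' scaler0 addr0.
    by rewrite scalerDr addrACA.
  - move=> t Jt; exists t, 0; rewrite scale0r addr0; split=> //.
    exact: (submodule0 subI).
  - move=> _ [j [k [Jj Ik ky ->]]] Ijk.
    rewrite scalerDl ky addr0; apply: FJ => //.
    by rewrite -(addrK k j); exact: (submoduleB subI Ijk Ik).
  by exists 0, r; rewrite add0r; split=> //; exact: (submodule0 subJ).
(* the ideals (J : x^n) form an ascending chain *)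
have colon_stable (x : R) : exists k, forall n (r : R),
    J (x ^+ (n + k) * r : R) -> J (x ^+ k * r : R).
  have [n r|k kP] := @noethR (fun n => bundle (ideal_colon (x ^+ n) subJ)).
    move=> /mem_bundle Jr; apply/mem_bundle; rewrite exprS -mulrA.
    exact: (submoduleZ x subJ).
  exists k => n r Jr; apply/(mem_bundle (ideal_colon (x ^+ k) subJ)).
  by rewrite -(kP (n + k)%N) ?leq_addl //; apply/mem_bundle.
have radJ (x : R) : x \in a -> exists k, J (x ^+ k : R).
  move=> xa; have [k kP] := colon_stable x; exists k.
  apply: (J_max' (fun t : R^o => exists j r : R, J j /\ t = j + x ^+ k * r)).
  - split=> [|c t t' [j [r [Jj ->]]] [j' [r' [Jj' ->]]]].
      by exists 0, 0; rewrite mulr0 addr0; split=> //; exact: (submodule0 subJ).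
    exists (c * j + j'), (c * r + r'); split; first exact: (subJ.2 c j j').
    by rewrite scalerDr mulrDr addrACA [c *: (_ * _)]mulrCA.
  - by move=> t Jt; exists t, 0; rewrite mulr0 addr0.
  - move=> _ [j [r [Jj ->]]] It; have /torsionP-/(_ noethR x xa)[n] := Iy _ It.
    rewrite scalerA => xt0; apply: FJ => //.
    apply: (submoduleD subJ) => //; apply: (kP n).
    have Jxt : J (x ^+ n * (j + x ^+ k * r) : R).
      by apply: ann_sub xt0; apply: (submoduleZ (x ^+ n) subI).
    rewrite exprD -mulrA; move: Jxt; rewrite mulrDr => Jxt.
    rewrite -[_ * _](addKr (x ^+ n * j)) addrC; apply: (submoduleB subJ) => //.
    exact: (submoduleZ (x ^+ n) subJ).
  by exists 0, 1; rewrite mulr1 add0r; split=> //; exact: (submodule0 subJ).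
have [||y' y'P] := injective_rel_Baer injE
    (phi := fun t e => exists i j : R, [/\ I i, J j, t = i + j & e = i *: y]).
- split=> [|c t e t' e' [i [j [Ii Jj -> ->]]] [i' [j' [Ii' Jj' -> ->]]]].
    by exists 0, 0; rewrite scale0r addr0; split=> //; [exact: (submodule0 subI)|exact: (submodule0 subJ)].
  exists (c * i + i'), (c * j + j'); split.
  + exact: (subI.2 c i i').
  + exact: (subJ.2 c j j').
  + by rewrite scalerDr addrACA.
  by rewrite scalerDl scalerA.
- move=> e [i [j [Ii Jj /esym/eqP]]]; rewrite addr_eq0 => /eqP ij ->.
  by apply: FJ => //; rewrite ij; have := submoduleB subJ (submodule0 subJ) Jj; rewrite sub0r.
exists y' => [|r Ir]; last first.
  by rewrite -(y'P r (r *: y)) //; exists r, 0; rewrite addr0; split=> //; exact: (submodule0 subJ).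
apply/(torsionP a noethR) => x /radJ[k Jk]; exists k.
rewrite -(y'P _ 0) //; exists 0, (x ^+ k); rewrite add0r scale0r.
by split=> //; exact: (submodule0 subI).
Qed.

(** By Baer's criterion: a map from an ideal I to the torsion of E is
    multiplication by some y in E, and [torsion_representative] moves y into
    the torsion. *)
Lemma torsion_injective (E : lmodType R) :
  injective_rel E -> injective_rel (Gamma a E).
Proof.
move=> injE; apply: Baer_injective_rel => phi lin_phi sv_phi.
have [||y yP] := injective_rel_Baer injE
    (phi := fun r e => exists2 g : Gamma a E, phi r g & val g = e).
- split=> [|c r e r' e' [g rg <-] [g' rg' <-]]; first by exists 0; first apply lin_phi.1.
  by exists (c *: g + g') => //; apply lin_phi.2.
- by move=> e [g /sv_phi-> <-].
have [||y' y't y'P] := @torsion_representative E (fun r => exists g, phi r g) y injE.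
- split=> [|c r r' [g rg] [g' rg']]; first by exists 0; apply lin_phi.1.
  by exists (c *: g + g'); apply lin_phi.2.
- by move=> r [g rg]; rewrite -(yP r (val g)); [apply: (valP g) | exists g].
exists (Submod y't) => r g rg; apply: val_inj; rewrite linearZ /= y'P; last by exists g.
by apply: yP; exists g.
Qed.

Lemma torsion_retraction (E : lmodType R) :
    injective_rel E ->
  exists q : {linear E -> E}, (forall v, q v \in torsion a E) /\
    (forall v, v \in torsion a E -> q v = v).
Proof.
move=> injE.
have [||p pP] := torsion_injective injE
    (phi := fun (e : E) (g : Gamma a E) => val g = e).
- by split=> // c e g e' g' <- <-.
- by move=> g g0; apply: val_inj.
exists ((val : {linear Gamma a E -> E}) \o p); split=> [v|v vt] /=.
  exact: (valP (p v)).
by rewrite (pP v (Submod vt)).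
Qed.

(** The torsion submodule, being injective, is a direct summand, so the quotient
    is isomorphic to a complement of it in E. *)
Lemma quotient_torsion_injective (E : lmodType R) :
  injective_rel E -> injective_rel (quotmod (torsion a E)).
Proof.
move=> injE B phi lin_phi sv_phi; pose pr := quot_proj (torsion a E).
have [q [qt q_id]] := torsion_retraction injE.
(* the section of the projection that kills the torsion submodule *)
have [|x [v vx ->]|x|sec secP] :=
    linear_rel_fun (rho := fun x e => exists2 v, pr v = x & e = v - q v).
- split=> [|c x e x' e' [v <- ->] [v' <- ->]].
    by exists 0; rewrite !linear0 // addr0.
  by exists (c *: v + v'); [exact: linearP | rewrite [q (_ + _)]linearP linear_combB].
- by rewrite q_id ?subrr //; apply/quot_proj_eq0.
- by have [v vx] := quot_proj_surj x; exists (v - q v), v.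
have pr_sec x : pr (sec x) = x.
  have [v vx] := quot_proj_surj x.
  rewrite (secP x (v - q v)); last by exists v.
  by rewrite linearB vx (_ : pr (q v) = 0) ?subr0 //; apply/quot_proj_eq0.
have [||h hP] := injE B (fun b e => exists2 x, phi b x & e = sec x).
- split=> [|c b e b' e' [x bx ->] [x' bx' ->]].
    by exists 0; [apply lin_phi.1 | rewrite linear0].
  by exists (c *: x + x'); [apply lin_phi.2 | rewrite linearP].
- by move=> e [x /sv_phi-> ->]; rewrite linear0.
exists (linear_of (fun c u v => linearP (pr \o h) c u v)) => b x bx /=.
by rewrite -[RHS]pr_sec (hP b (sec x)) //; exists x.
Qed.

Lemma quotient_torsion_free (V : lmodType R) (x : quotmod (torsion a V)) :
  tors a (fun u => u = 0) x -> x = 0.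
Proof.
have [v <-] := quot_proj_surj x => tv.
apply/quot_proj_eq0/(torsionP a noethR)/tors_idem => r ra.
have [k rv] := tv r ra; exists k; apply/(torsionP a noethR)/quot_proj_eq0.
by rewrite linearZ.
Qed.

End TorsionOfInjective.

(** * Coboundaries and the cone of a homothety *)

Section Coboundaries.
Variables (R : comNzRingType) (C : cochain_complex R).

(** Coboundaries as a submodule of the cochains in degree k, those in degree 0
    being zero; the coboundaries of a cohomology module live inside the
    cocycles instead. *)
Definition cobound k : C k -> Prop :=
  match k return C k -> Prop with
  | 0 => fun z => z = 0
  | j.+1 => fun z => exists y : C j, cc_d C j y = z
  end.

Lemma cobound_submodule k : submodule (@cobound k).
Proof.
case: k => [|k]; first exact: submodule_zero.
split=> [|c u v [y <-] [z <-]]; first by exists 0; rewrite linear0.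
by exists (c *: y + z); rewrite linearP.
Qed.

Lemma cocycle_submodule k : submodule (fun z : C k => cc_d C k z = 0).
Proof.
by split=> [|c u v du dv]; rewrite ?linear0 // linearP du dv scaler0 addr0.
Qed.

Lemma cobound_cocycle k (z : C k) : cobound z -> cc_d C k z = 0.
Proof. by case: k z => [|k] z => [->|[y <-]]; rewrite ?linear0 ?cc_dd. Qed.

(** A complex of injectives that is exact below degree m is split there: from a
    projection p onto the coboundaries in degree m one gets the map d y |-> y - p y,
    which extends to all of degree m+1, and composing with d gives the next
    projection. *)
Lemma cobound_projection m :
    (forall k, injective_rel (C k)) ->
    (forall k (z : C k), (k < m)%N -> cc_d C k z = 0 -> cobound z) ->
  exists p : {linear C m -> C m},
    (forall z, cobound (p z)) /\ (forall z, cobound z -> p z = z).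
Proof.
move=> injC; elim: m => [|m IHm] exC; first by exists \0; split=> // z ->.
have [k z km|p [pB p_id]] := IHm; first by apply: exC; apply: ltnW.
have [||s sP] := injC m (C m.+1)
    (fun z w => exists2 y, cc_d C m y = z & w = y - p y).
- split=> [|c z w z' w' [y <- ->] [y' <- ->]].
    by exists 0; rewrite !linear0 // addr0.
  by exists (c *: y + y'); [exact: linearP | rewrite [p (_ + _)]linearP linear_combB].
- by move=> w [y /exC yB ->]; rewrite p_id ?subrr //; apply: yB.
exists (linear_of (fun c u v => linearP (cc_d C m \o s) c u v)); split=> [z|z [y <-]] /=.
  by exists (s z).
rewrite (sP _ (y - p y)); last by exists y.
by rewrite linearB /= (cobound_cocycle (pB y)) subr0.
Qed.

(** The coboundaries are a direct summand of a torsion-free module, so the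
    quotient by them is torsion-free. *)
Lemma cobound_tors_closed (a : submodClosed R^o) m :
    (forall k, injective_rel (C k)) ->
    (forall k (z : C k), tors a (fun u => u = 0) z -> z = 0) ->
    (forall k (z : C k), (k < m)%N -> cc_d C k z = 0 -> cobound z) ->
  forall z : C m, tors a (@cobound m) z -> cobound z.
Proof.
move=> injC tfC exC z tz; have [p [pB p_id]] := cobound_projection injC exC.
rewrite -(subrK (p z) z) [z - p z]tfC ?add0r // => r ra.
have [k Bz] := tz r ra; exists k.
by rewrite scalerBr -linearZ /= p_id // subrr.
Qed.

End Coboundaries.

Section Cone.
Variables (R : comNzRingType) (C : cochain_complex R) (x : R).

(** The mapping cone of multiplication by x on C, shifted so that it starts in
    degree 0. *)
Definition cone_mod (k : nat) : lmodType R :=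
  if k is j.+1 then (C j.+1 * C j)%type : lmodType R else C 0%N.

Fact cone_d0_linear : linear (fun z : C 0%N => (cc_d C 0 z, x *: z)).
Proof. by move=> c u v; rewrite linearP scalerDr scalerA mulrC -scalerA. Qed.

Fact cone_dS_linear j : linear (fun z : (C j.+1 * C j)%type =>
  (cc_d C j.+1 z.1, x *: z.1 - cc_d C j z.2)).
Proof.
move=> c [u1 u2] [v1 v2] /=; rewrite /=.
rewrite (linearP (cc_d C j.+1)) (linearP (cc_d C j)) scalerDr scalerA mulrC -scalerA.
by rewrite linear_combB.
Qed.

Definition cone_d k : {linear cone_mod k -> cone_mod k.+1} :=
  match k return {linear cone_mod k -> cone_mod k.+1} with
  | 0 => linear_of cone_d0_linear
  | j.+1 => linear_of (@cone_dS_linear j)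
  end.

Fact cone_dd k z : cone_d k.+1 (cone_d k z) = 0.
Proof.
case: k z => [|k] z /=; rewrite cc_dd.
  by rewrite linearZ subrr.
by rewrite linearB /= cc_dd subr0 linearZ subrr.
Qed.

Definition cone : cochain_complex R := CochainComplex cone_dd.

Lemma cone_cocycle k (z : C k.+1) (w : C k) :
  cc_d cone k.+1 (z, w) = 0 <->
  cc_d C k.+1 z = 0 /\ x *: z = cc_d C k w.
Proof.
split=> [[-> /eqP]|[dz xz]]; first by rewrite subr_eq0 => /eqP.
by rewrite /= dz xz subrr.
Qed.

(** Written so as to cover degree 1, where the second component has no
    differential entering it. *)
Lemma cone_cobound k (z : C k.+1) (w : C k) :
  @cobound R cone k.+1 (z, w) <->
  exists y, cc_d C k y = z /\ cobound (w - x *: y).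
Proof.
split.
  case: k z w => [|k] z w [].
    by move=> y [<- <-]; exists y; rewrite subrr.
  move=> [y u] [<- <-]; exists y; split=> //; exists (- u).
  by rewrite linearN addrAC subrr add0r.
case: k z w => [|k] z w [y [<-]].
  by move=> /eqP; rewrite subr_eq0 => /eqP->; exists y.
move=> [u /eqP]; rewrite eq_sym subr_eq => /eqP->; exists (y, - u) => /=.
by rewrite linearN opprK addrC.
Qed.

Lemma cone_injective k :
  (forall j, injective_rel (C j)) -> injective_rel (cone k).
Proof. by move=> injC; case: k => [|k] //=; apply: injective_rel_prod. Qed.

Lemma cone_torsion_free (a : submodClosed R^o) k :
    (forall j (z : C j), tors a (fun u => u = 0) z -> z = 0) ->
  forall z : cone k, tors a (fun u => u = 0) z -> z = 0.
Proof.
move=> tfC; case: k => [|k] /=; first exact: tfC.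
move=> [z w] tzw.
have -> : z = 0 by apply: tfC => r /tzw[l] [zl _]; exists l.
by have -> : w = 0 by apply: tfC => r /tzw[l] [_ wl]; exists l.
Qed.

End Cone.

(** * Dimension shifting along an ideal transform *)

Section IdealTransforms.
Variables (R : comNzRingType) (a : submodClosed R^o) (M : lmodType R).

(** The classes in degree m that come from M. *)
Definition cobound_mod (C : cochain_complex R) m (f : M -> C m) (z : C m) : Prop :=
  exists v, cobound (z - f v).

(** A complex of torsion-free injectives that computes the derived functors of
    the ideal transform D_a on M/N, placed in degree m. Its cohomology W in
    degree m receives M/N with torsion kernel and cokernel, i.e. W = D_a(M/N)
    and coker(f) = H^1_a(M/N); for i > 0 its cohomology in degree m+i is
    H^(i+1)_a(M/N). *)
Record transform_complex (C : cochain_complex R) (m : nat)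
    (f : {linear M -> C m}) (N : M -> Prop) : Prop := TransformComplex {
  tc_injective : forall k, injective_rel (C k);
  tc_torsion_free : forall k (z : C k), tors a (fun u => u = 0) z -> z = 0;
  tc_exact : forall k (z : C k), (k < m)%N -> cc_d C k z = 0 -> cobound z;
  tc_tors : forall k (z : C k),
    (m < k)%N -> cc_d C k z = 0 -> tors a (@cobound R C k) z;
  tc_cocycle : forall v, cc_d C m (f v) = 0;
  tc_zero : forall v, N v -> cobound (f v);
  tc_kernel : forall v, cobound (f v) -> tors a N v;
  tc_cokernel : forall z : C m, cc_d C m z = 0 -> tors a (cobound_mod f) z
}.

Lemma cobound_mod_submodule (C : cochain_complex R) m (f : {linear M -> C m}) :
  submodule (cobound_mod f).
Proof.
have [B0 BL] := cobound_submodule C m.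
split=> [|c z z' [v Bz] [v' Bz']]; first by exists 0; rewrite linear0 subr0.
by exists (c *: v + v'); rewrite (linearP f) linear_combB; apply: BL.
Qed.

Section OneComplex.
Variables (C : cochain_complex R) (m : nat) (f : {linear M -> C m}).
Variables (N : M -> Prop) (subN : submodule N).
Hypothesis tcC : transform_complex f N.
Variable x : R.
Hypothesis x_mem : x \in a.
Hypothesis x_reg : forall v, tors a N (x *: v) -> tors a N v.

Let subB k : submodule (@cobound R C k) := cobound_submodule C k.

Lemma tc_tors_zero v : tors a N v -> cobound (f v).
Proof.
move=> tv; apply: (cobound_tors_closed (tc_injective tcC) (tc_torsion_free tcC)
  (tc_exact tcC)) => r /tv[k /(tc_zero tcC)].
by rewrite linearZ; exists k.
Qed.

(** W is torsion-free and it is torsion modulo the image of M, on which x is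
    regular. *)
Lemma tc_regular z : cc_d C m z = 0 -> cobound (x *: z) -> cobound z.
Proof.
move=> dz Bxz; apply: (cobound_tors_closed (tc_injective tcC)
  (tc_torsion_free tcC) (tc_exact tcC)) => r ra.
have [k [v Bv]] := tc_cokernel tcC dz ra; exists k.
suff fv : cobound (f v) by rewrite -(subrK (f v) (_ *: z)); apply: submoduleD.
apply/tc_tors_zero/x_reg/(tc_kernel tcC).
have := submoduleB (subB m) (submoduleZ (r ^+ k) (subB m) Bxz)
  (submoduleZ x (subB m) Bv).
rewrite scalerBr !scalerA [x * _]mulrC opprB addrCA subrr addr0.
by rewrite -linearZ.
Qed.

Lemma tc_exact_regular k (z : C k) :
  (k <= m)%N -> cc_d C k z = 0 -> cobound (x *: z) -> cobound z.
Proof.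
rewrite leq_eqVlt => /predU1P[km|km dz _]; last exact: (tc_exact tcC).
by subst k; apply: tc_regular.
Qed.

(** The submodule T + xM, where T/N is the torsion of M/N, so that M/(T + xM) is
    the quotient by x of the torsion-free module M/T. *)
Definition tors_plus_mult : M -> Prop := fun v => exists u, tors a N (v - x *: u).

Lemma tors_plus_mult_submodule : submodule tors_plus_mult.
Proof.
have [T0 TL] := tors_submodule a subN.
split=> [|c v v' [u Tu] [u' Tu']]; first by exists 0; rewrite scaler0 subr0.
exists (c *: u + u'); rewrite scalerDr scalerA mulrC -scalerA.
by rewrite linear_combB; apply: TL.
Qed.

(** Base case, H^1_a. The cokernel of X = M/T in W is torsion, so it is enough to
    bound its part killed by x. As x is regular on W, multiplication by x
    identifies this part with (xW inter X)/xX, a submodule of X/xX = M/(T + xM),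
    and a torsion one because W/X is. *)
Lemma cokernel_artinian :
    artinian_mod (tors a tors_plus_mult) tors_plus_mult ->
  artinian_mod (fun z => cc_d C m z = 0) (cobound_mod f).
Proof.
move=> artM.
have sub_cm := cobound_mod_submodule f.
apply: (artinian_mod_power_torsion (x := x)) => //.
- exact: cocycle_submodule.
- move=> z [v /cobound_cocycle].
  by rewrite linearB /= (tc_cocycle tcC) subr0.
- by move=> z /(tc_cokernel tcC)/(_ _ x_mem).
pose rho (z : C m) v := cobound (x *: z - f v).
have lin_rho : linear_rel rho.
  split=> [|c z v z' v' zv zv'].
    by rewrite /rho scaler0 linear0 subr0; apply: submodule0.
  rewrite /rho (linearP f) scalerDr scalerA mulrC -scalerA linear_combB.
  exact: (subB m).2.
apply: artinian_mod_rel lin_rho _ _ _ _ _ _ artM.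
- apply: submoduleI; first exact: cocycle_submodule.
  exact: submodule_scale.
- exact/tors_submodule/tors_plus_mult_submodule.
- exact: tors_plus_mult_submodule.
- by move=> v; apply: mem_tors.
- move=> z [dz [v Bv]]; exists v => // r ra.
  have [k [u Bu]] := tc_cokernel tcC dz ra; exists k, u.
  apply: (tc_kernel tcC); rewrite (linearB f) !(linearZ_LR f).
  have := submoduleB (subB m) (submoduleZ x (subB m) Bu)
    (submoduleZ (r ^+ k) (subB m) Bv).
  rewrite scalerBr [_ *: (_ - f v)]scalerBr !scalerA [x * _]mulrC.
  by rewrite opprB addrC addrA subrK.
move=> z v [dz _] [u /tc_tors_zero Bu] Bz; exists u; apply: tc_regular.
  by rewrite linearB /= dz (tc_cocycle tcC) subr0.
have := submoduleD (subB m) Bz Bu.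
by rewrite linearB /= linearZ addrA subrK scalerBr.
Qed.

Fact cone_map_linear : linear (fun v => (0, f v) : cone C x m.+1).
Proof.
move=> c u v; apply: (f_equal2 pair); last exact: (linearP f).
by rewrite /= scaler0 addr0.
Qed.

Definition cone_map : {linear M -> cone C x m.+1} := linear_of cone_map_linear.

(** Multiplication by x is injective on W, so its cone has no cohomology in
    degree m, and in degree m+1 its cohomology contains W/xW with torsion
    cokernel; W/xW receives M/(T + xM) with torsion kernel and cokernel. *)
Lemma cone_transform_complex : transform_complex cone_map tors_plus_mult.
Proof.
split.
- by move=> k; apply/cone_injective/(tc_injective tcC).
- by move=> k; apply/cone_torsion_free/(tc_torsion_free tcC).
(* degrees up to m: z is a coboundary d y, and w - x y is a cocycle in a
     degree where C is exact *)
- move=> [|k] z km; first by case=> dz xz; apply: (@tc_exact_regular 0%N).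
  case: z => z w /cone_cocycle[dz xz]; apply/cone_cobound.
  have [|y yz] := @tc_exact_regular k.+1 z km dz; first by exists w.
  exists y; split=> //; apply: (tc_exact tcC) => //.
  by rewrite linearB linearZ /= yz xz subrr.
- move=> [//|k] [z w] km /cone_cocycle[dz xz] r ra.
  have [l [y yz]] := tc_tors tcC (ltnW km) dz ra.
  have [|n Bn] := tc_tors tcC (k := k) (z := r ^+ l *: w - x *: y) km _ ra.
    by rewrite linearB !(linearZ_LR (cc_d C _)) /= yz -xz !scalerA mulrC subrr.
  exists (n + l)%N; rewrite exprD -scalerA; apply/cone_cobound.
  exists (r ^+ n *: y); rewrite linearZ /= yz; split=> //.
  by rewrite [x *: (_ *: _)]scalerA [x * _]mulrC -scalerA -scalerBr.
- by move=> v; apply/cone_cocycle; rewrite linear0 scaler0 (tc_cocycle tcC).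
- move=> v [u Tu]; apply/cone_cobound; exists (f u).
  by rewrite (tc_cocycle tcC) -linearZ -linearB; split=> //; apply: tc_tors_zero.
- move=> v /cone_cobound[y [dy By]] r ra.
  have [k [u Bu]] := tc_cokernel tcC dy ra; exists k, u.
  apply: (tc_kernel tcC); rewrite (linearB f) !(linearZ_LR f).
  have := submoduleD (subB m) (submoduleZ x (subB m) Bu)
    (submoduleZ (r ^+ k) (subB m) By).
  rewrite !scalerBr !scalerA [x * _]mulrC.
  by rewrite addrC addrA subrK.
move=> [z w] /cone_cocycle[dz xz] r ra.
have [l [y yz]] := tc_tors tcC (ltnSn m) dz ra.
have [|n [v Bv]] := tc_cokernel tcC (z := r ^+ l *: w - x *: y) _ ra.
  by rewrite linearB !(linearZ_LR (cc_d C _)) /= yz -xz !scalerA mulrC subrr.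
exists (n + l)%N, v; rewrite exprD -scalerA.
rewrite [X in cobound X](_ : _ =
  (r ^+ n *: (r ^+ l *: z), r ^+ n *: (r ^+ l *: w) - f v)); last first.
  by rewrite -[_ *: (_ *: z)]subr0.
apply/cone_cobound; exists (r ^+ n *: y); rewrite linearZ /= yz; split=> //.
by rewrite [x *: (_ *: _)]scalerA [x * _]mulrC -scalerA addrAC -scalerBr.
Qed.

(** A cocycle z with x z = d w lifts to the cocycle (z, w) of the cone, which is
    the long exact sequence at the point where it is needed: the cohomology
    of the cone maps onto the x-annihilated part of the next one of C. *)
Lemma cone_artinian k (Q : cone C x k.+1 -> Prop) :
    submodule Q -> (forall z w, Q (z, w) -> cobound z) ->
    (forall z, Q z -> cc_d (cone C x) k.+1 z = 0) ->
    artinian_mod (fun z => cc_d (cone C x) k.+1 z = 0) Q ->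
  artinian_mod (fun z : C k.+1 => cc_d C k.+1 z = 0 /\ cobound (x *: z)) (@cobound R C k.+1).
Proof.
move=> subQ Q1 QZ artQ.
apply: (artinian_mod_rel (rho := fun z zw => zw.1 = z) _ _ _ _ _ _ _ artQ).
- by split=> [//|c z zw z' zw' <- <-].
- apply: submoduleI; first exact: cocycle_submodule.
  exact/submodule_scale/cobound_submodule.
- exact: cocycle_submodule.
- by [].
- by [].
- by move=> z [dz [w dw]]; exists (z, w) => //; apply/cone_cocycle.
by move=> z [z' w] _ Qzw /= <-; apply: Q1 Qzw.
Qed.

End OneComplex.

Hypothesis gamma_artinian :
  forall N : M -> Prop, submodule N -> artinian_mod (tors a N) N.
Hypothesis regular_element : forall N : M -> Prop, submodule N ->
  exists2 x, x \in a & forall v, tors a N (x *: v) -> tors a N v.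

Lemma transform_cokernel_artinian (C : cochain_complex R) m
    (f : {linear M -> C m}) (N : M -> Prop) :
    submodule N -> transform_complex f N ->
  artinian_mod (fun z => cc_d C m z = 0) (cobound_mod f).
Proof.
move=> subN tcC; have [x xa x_reg] := regular_element subN.
exact: (cokernel_artinian subN tcC xa x_reg (gamma_artinian (tors_plus_mult_submodule subN x))).
Qed.

(** Induction on i: the cohomology is torsion, and its part killed by x is a
    quotient of the cohomology of the cone, a transform complex for M/(T + xM) in
    degree m+1; this is one step closer to the degree of the module. *)
Lemma transform_cohomology_artinian i (C : cochain_complex R) m
    (f : {linear M -> C m}) (N : M -> Prop) :
    submodule N -> transform_complex f N ->
  artinian_mod (fun z => cc_d C (m + i).+1 z = 0) (@cobound R C (m + i).+1).
Proof.
elim: i C m f N => [|i IHi] C m f N subN tcC;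
  have [x xa x_reg] := regular_element subN;
  have tcD := cone_transform_complex tcC x_reg;
  have subD := tors_plus_mult_submodule subN x;
  (apply: (artinian_mod_power_torsion (x := x));
    [exact: cocycle_submodule | exact: cobound_submodule
    | by move=> z; apply: cobound_cocycle
    | by move=> z /(tc_tors tcC); apply => //; rewrite ltnS leq_addr | ]).
  rewrite addn0; apply: cone_artinian (transform_cokernel_artinian subD tcD).
  - exact: cobound_mod_submodule.
  - move=> z w [v]; rewrite [X in cobound X](_ : _ = (z, w - f v)); last first.
      by rewrite -[z in RHS]subr0.
    by move=> /cone_cobound[y [<- _]]; exists y.
  - move=> z [v /cobound_cocycle]; rewrite linearB => /eqP.
    by rewrite (tc_cocycle tcD) subr0 => /eqP.
rewrite addnS -addSn.
apply: cone_artinian (IHi (cone C x) m.+1 (cone_map f x) _ subD tcD).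
- exact: cobound_submodule.
- by move=> z w /cone_cobound[y [<- _]]; exists y.
- by move=> z; apply: cobound_cocycle.
Qed.

End IdealTransforms.

(** * From a ZD-module to local cohomology *)

Section PrimeAvoidance.
Variables (R : comNzRingType) (a : submodClosed R^o).
Variables (n : nat) (p : 'I_n -> prime_idealr R).

Lemma prime_prodN (I : finType) (q : prime_idealr R) (S : {set I}) (t : I -> R) :
  (forall i, i \in S -> t i \notin q) -> \prod_(i in S) t i \notin q.
Proof.
move=> tq; apply: (big_ind (fun r => r \notin q)) => //; first by rewrite idealr1.
by move=> r s rq sq; rewrite prime_idealrM negb_or rq.
Qed.

(** Stated for the subfamilies S of a family, for an induction on their size. If
    p_j is contained in p_i, avoiding p_i avoids p_j. Otherwise, an x avoiding
    all but p_i is corrected by an element of a and of all the p_j outside p_i. *)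
Lemma prime_avoidance (S : {set 'I_n}) :
    (forall i, i \in S -> exists2 x : R, x \in a & x \notin p i) ->
  exists2 x : R, x \in a & forall i, i \in S -> x \notin p i.
Proof.
elim: {S}_.+1 {-2}S (ltnSn #|S|) => // k IHk S Sk a_p.
have [->|[i iS]] := set_0Vmem S.
  by exists 0 => [|i]; [exact: (rpred0 a) | rewrite inE].
have IH j : j \in S -> exists2 x : R, x \in a & forall l, l \in S :\ j -> x \notin p l.
  move=> jS; apply: IHk => [|l]; last by rewrite inE => /andP[_ /a_p].
  by rewrite (cardsD1 j S) jS in Sk.
have [[j jSi p_ji]|sep] := EM (exists2 j, j \in S :\ i & {subset p j <= p i}).
  have /setD1P[ji jS] := jSi.
  have [x xa xP] := IH j jS; exists x => // l lS.
  have [->|lj] := eqVneq l j; last by apply: xP; rewrite !inE lj.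
  by apply: contra (p_ji x) _; apply: xP; rewrite !inE eq_sym ji.
have [x xa xP] := IH i iS.
have xS l : l \in S -> l != i -> x \notin p l.
  by move=> lS li; apply: xP; rewrite !inE li.
have [xi|xi] := boolP (x \in p i); last first.
  by exists x => // l lS; have [->//|] := eqVneq l i; apply: xS.
have t_ex j : exists t : R, j \in S :\ i -> t \in p j /\ t \notin p i.
  have [jSi|] := boolP (j \in S :\ i); last by exists 0.
  apply: contrapT => no_t; apply: sep; exists j => // t tj.
  by apply: contraT => ti; case: no_t; exists t.
have [t tP] := choice t_ex; have [u ua ui] := a_p i iS.
pose y := u * \prod_(j in S :\ i) t j.
have ya : y \in a by rewrite /y mulrC; apply: (@rpredZ _ _ a).
have yi : y \notin p i.
  rewrite prime_idealrM negb_or ui; apply: prime_prodN => j /tP[].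
  by [].
have yj j : j \in S :\ i -> y \in p j.
  move=> jSi; rewrite /y (bigD1 j) //= mulrCA mulrC.
  by apply: idealMr; case: (tP j jSi).
exists (x + y) => [|l lS]; first exact: (rpredD (S := a)).
have [->|li] := eqVneq l i.
  by apply: contra yi => xyi; rewrite -[y](addKr x) addrC rpredB.
have yl : y \in p l by apply: yj; rewrite !inE li.
by apply: contra (xS l lS li) => xyl; rewrite -[x](addrK y) rpredB.
Qed.

End PrimeAvoidance.

Section QuotientsOfZD.
Variables (R : comNzRingType) (a : submodClosed R^o) (M : lmodType R).

(** Let T/N be the torsion of M/N. If no element of a were regular on M/T, then
    a would be contained in the finite union of the associated primes of M/T
    that are given by the ZD property, hence in one of them. This one is the
    annihilator of a nonzero element, which would be a-torsion, against the
    choice of T. *)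
Lemma ZD_regular_element (N : M -> Prop) :
    ZD_module M -> submodule N ->
  exists2 x : R, x \in a & forall v, tors a N (x *: v) -> tors a N v.
Proof.
move=> ZD_M subN; have subT := tors_submodule a subN.
have [n [p [assoc_p zd_p]]] := ZD_M (bundle subT).
have inT v : quot_proj (bundle subT) v = 0 <-> tors a N v.
  exact: iff_trans (quot_proj_eq0 _ _) (mem_bundle subT v).
have [|x xa xP] := @prime_avoidance R a n p [set: 'I_n].
  move=> i _; apply: contrapT => a_pi.
  have [x xP] := assoc_p i; have [v vx] := quot_proj_surj x.
  have v_tors : tors a N v.
    apply: tors_idem => r ra; exists 1%N; apply/inT.
    rewrite linearZ_LR vx; apply/eqP; rewrite -xP.
    by apply: contrapT => /negP rpi; apply: a_pi; exists r.
  have := idealr1 (p i); rewrite xP -vx scale1r.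
  by move/inT: v_tors => /= ->; rewrite eqxx.
exists x => // v xv; apply: contrapT => nTv.
have /zd_p[i xi] : zero_divisor_on (quotmod (bundle subT)) x.
  exists (quot_proj (bundle subT) v); first by apply/eqP => /inT.
  by rewrite -linearZ; apply/inT.
by have := xP i (in_setT i); rewrite xi.
Qed.

Hypothesis noethR : noetherian R^o.

Lemma gamma_quotient_artinian (N : M -> Prop) (subN : submodule N) :
  artinian (Gamma a (quotmod (bundle subN))) -> artinian_mod (tors a N) N.
Proof.
have inN v : quot_proj (bundle subN) v = 0 <-> N v.
  exact: iff_trans (quot_proj_eq0 _ _) (mem_bundle subN v).
move=> /artinian_modP; apply: (artinian_mod_rel
  (rho := fun v (g : Gamma a (quotmod (bundle subN))) => quot_proj _ v = val g)).
- by split=> [|c u v u' v' uv uv']; rewrite ?linear0 // linearP uv uv'.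
- exact: tors_submodule.
- by [].
- exact: submodule_zero.
- by [].
- move=> v tv; have vt : quot_proj (bundle subN) v \in torsion a _.
    apply/(torsionP a noethR) => r /tv[k Nv]; exists k.
    by rewrite -linearZ; apply/inN.
  by exists (Submod vt).
by move=> v g _ -> /inN.
Qed.

End QuotientsOfZD.

Section TorsionFreeQuotientComplex.
Variables (R : comNzRingType) (a : submodClosed R^o).

Section Map.
Variables (U V : lmodType R) (f : {linear U -> V}).

Lemma quot_torsion_map_ex : exists g : {linear quotmod (torsion a U) -> quotmod (torsion a V)},
  forall u, g (quot_proj _ u) = quot_proj _ (f u).
Proof.
have [|y [u /quot_proj_eq0 ut <-]|x|g gP] := linear_rel_fun
    (rho := fun x y => exists2 u, quot_proj (torsion a U) u = x & quot_proj (torsion a V) (f u) = y).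
- split=> [|c x y x' y' [u <- <-] [u' <- <-]]; first by exists 0; rewrite !linear0.
  by exists (c *: u + u'); [exact: linearP | rewrite (linearP f) linearP].
- by apply/quot_proj_eq0/torsion_linear.
- by have [u <-] := quot_proj_surj x; exists (quot_proj _ (f u)), u.
by exists g => u; apply: gP; exists u.
Qed.

Definition quot_torsion_map := projT1 (cid quot_torsion_map_ex).

Lemma quot_torsion_mapE u : quot_torsion_map (quot_proj _ u) = quot_proj _ (f u).
Proof. exact: projT2 (cid quot_torsion_map_ex) u. Qed.
End Map.

Fact quot_torsion_dd (C : cochain_complex R) i x :
  quot_torsion_map (cc_d C i.+1) (quot_torsion_map (cc_d C i) x) = 0.
Proof.
by have [u <-] := quot_proj_surj x; rewrite !quot_torsion_mapE cc_dd linear0.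
Qed.

Definition quot_torsion_complex (C : cochain_complex R) : cochain_complex R :=
  @CochainComplex R (fun i => quotmod (torsion a (C i)))
    (fun i => quot_torsion_map (cc_d C i)) (quot_torsion_dd (C := C)).

Hypothesis noethR : noetherian R^o.
Variables (M : lmodType R) (N : submodClosed M).
Variable E : injective_resolution (quotmod N).

Local Notation G := (quot_torsion_complex E).

Definition resolution_map : {linear M -> G 0%N} :=
  quot_proj (torsion a (E 0%N)) \o (ir_aug E \o quot_proj N).

Lemma resolution_mapE v :
  resolution_map v = quot_proj _ (ir_aug E (quot_proj N v)).
Proof. by []. Qed.

Lemma quot_torsion_cocycle k (e : E k) :
  cc_d G k (quot_proj _ e) = 0 <-> tors a (fun u => u = 0) (cc_d E k e).
Proof.
rewrite /= quot_torsion_mapE.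
exact: iff_trans (quot_proj_eq0 _ _) (torsionP a noethR _).
Qed.

Lemma resolution_kernel v : ir_aug E (quot_proj N v) = 0 <-> v \in N.
Proof.
rewrite -quot_proj_eq0; split=> [|->]; last exact: linear0.
by rewrite -[0 in X in X -> _](linear0 (ir_aug E)) => /(@ir_aug_inj _ _ E).
Qed.

(** For an injective resolution E of M/N, the terms of E/Gamma_a(E) are
    torsion-free injectives. If d e is a-torsion, then a power of any element
    of a makes e a cocycle of E, so the cohomology is torsion in positive degrees
    and M/N maps to degree 0 with torsion cokernel. *)
Lemma resolution_transform_complex :
  transform_complex a resolution_map (fun v => v \in N).
Proof.
split=> [k|k|//|[//|k] z _|v|v vN|v v0|z].
- by apply: quotient_torsion_injective => //; apply/injective_module_rel/ir_injective.
- exact: quotient_torsion_free.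
- have [e <-] := quot_proj_surj z => /quot_torsion_cocycle te r ra.
  have [l] := te r ra; rewrite -linearZ /= => /ir_exactS[e' de'].
  by exists l, (quot_proj _ e'); rewrite /= quot_torsion_mapE de' linearZ.
- apply/quot_torsion_cocycle; rewrite (_ : cc_d E 0 _ = 0).
    by apply: submodule0; apply/tors_submodule/submodule_zero.
  by apply/ir_exact0; exists (quot_proj N v).
- by move/resolution_kernel: vN => vN; rewrite /cobound resolution_mapE vN linear0.
- have /quot_proj_eq0/(torsionP a noethR) tv := v0.
  move=> r /tv[k]; rewrite -!linearZ => /resolution_kernel; by exists k.
have [e <-] := quot_proj_surj z => /quot_torsion_cocycle te r ra.
have [l] := te r ra; rewrite -linearZ /= => /ir_exact0[x ex].
have [v vx] := quot_proj_surj x; exists l, v.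
by rewrite /cobound resolution_mapE vx ex linearZ_LR subrr.
Qed.

(** The zeroth local cohomology is Gamma_a(M/N). *)
Lemma local_cohomology0_artinian :
    artinian_mod (tors a (fun v => v \in N)) (fun v => v \in N) ->
  artinian (local_cohomology a E 0).
Proof.
move=> artM; apply/artinian_modP; set H := local_cohomology a E 0.
pose Z := submod (cocycle (Gamma_complex a E) 0).
pose pr : {linear Z -> H} := quot_proj _.
pose u : {linear Z -> E 0%N} := (val : {linear Gamma a (E 0%N) -> E 0%N}) \o
  (val : {linear Z -> Gamma a (E 0%N)}).
apply: (artinian_mod_rel (rho := fun (c : H) v => exists2 z : Z, pr z = c &
    u z = ir_aug E (quot_proj N v)) _ _ _ _ _ _ _ artM).
- split=> [|c h v h' v' [z <- zv] [z' <- zv']]; first by exists 0; rewrite ?linear0.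
  exists (c *: z + z'); first exact: linearP.
  by rewrite (linearP u) zv zv' (linearP (quot_proj N)) (linearP (ir_aug E)).
- by [].
- exact/tors_submodule/submodule_mem.
- exact: submodule_mem.
- by move=> v; apply: mem_tors.
- move=> c _; have [z zc] := quot_proj_surj c.
  have /eqP/(congr1 val)/= dz := valP z.
  have /ir_exact0[x xz] := dz; have [v vx] := quot_proj_surj x; subst x.
  exists v; last by exists z; [exact: zc | exact: esym xz].
  have /(torsionP a noethR) tz := valP (val z).
  move=> r /tz[k rz]; exists k; apply/resolution_kernel.
  by rewrite !linearZ_LR xz.
move=> c v _ /resolution_kernel vN [z <- zv]; apply/quot_proj_eq0.
apply/eqP; apply: val_inj; apply: val_inj.
by rewrite [LHS]zv vN.
Qed.

(** The connecting map of 0 -> Gamma_a(E) -> E -> E/Gamma_a(E) -> 0: a torsion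
    cocycle is d e for some e, whose class is a cocycle of the quotient. Q stands
    for the coboundaries when k > 0, and for the classes coming from M when
    k = 0. *)
Lemma local_cohomologyS_artinian k (Q : G k -> Prop) :
    submodule Q -> (forall y, Q y -> cc_d G k y = 0) ->
    (forall e, Q (quot_proj _ e) ->
      exists2 t, t \in torsion a (E k) & cc_d E k t = cc_d E k e) ->
    artinian_mod (fun y => cc_d G k y = 0) Q ->
  artinian (local_cohomology a E k.+1).
Proof.
move=> subQ QZ QB artG; apply/artinian_modP; set H := local_cohomology a E k.+1.
pose Z := submod (cocycle (Gamma_complex a E) k.+1).
pose pr : {linear Z -> H} := quot_proj _.
apply: (artinian_mod_rel (rho := fun (c : H) (y : G k) => exists (z : Z) e,
    [/\ pr z = c, val (val z) = cc_d E k e & quot_proj _ e = y]) _ _ _ _ _ _ _ artG).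
- split=> [|c h y h' y' [z [e [<- ze <-]]] [z' [e' [<- ze' <-]]]].
    by exists 0, 0; rewrite ?linear0.
  exists (c *: z + z'), (c *: e + e'); split; rewrite ?linearP //.
  by rewrite -ze -ze'.
- by [].
- exact: cocycle_submodule.
- by [].
- by [].
- move=> c _; have [z zc] := quot_proj_surj c.
  have /eqP/(congr1 val)/= dz := valP z.
  have /ir_exactS[e ze] := dz.
  exists (quot_proj _ e); last by exists z, e; split=> //; rewrite ze.
  by apply/quot_torsion_cocycle/(torsionP a noethR); rewrite ze; apply: (valP (val z)).
move=> c y _ Qy [z [e [<- ze ey]]]; apply/quot_proj_eq0.
have [|t tt te] := QB e; first by rewrite ey.
by apply/asboolP; exists (Submod tt); apply: val_inj; rewrite /= te.
Qed.

End TorsionFreeQuotientComplex.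

Lemma gamma_local_cohomology0 (R : comNzRingType) (a : submodClosed R^o)
    (X : lmodType R) (E : injective_resolution X) :
  artinian (local_cohomology a E 0) -> artinian (Gamma a X).
Proof.
set H := local_cohomology a E 0; move=> /artinian_modP artH; apply/artinian_modP.
pose Z := submod (cocycle (Gamma_complex a E) 0).
pose pr : {linear Z -> H} := quot_proj _.
apply: (artinian_mod_rel (rho := fun (x : Gamma a X) (c : H) =>
  exists2 z : Z, pr z = c & val (val z) = ir_aug E (val x)) _ _ _ _ _ _ _ artH).
- split=> [|c h v h' v' [z <- zv] [z' <- zv']]; first by exists 0; rewrite ?linear0.
  exists (c *: z + z'); first exact: linearP.
  by rewrite [val (_ + _)]linearP linearP -zv -zv'.
- by [].
- by [].
- exact: submodule_zero.
- by [].
- move=> x _; pose g : Gamma a (E 0%N) := Gamma_map a (ir_aug E) x.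
  have gZ : g \in cocycle (Gamma_complex a E) 0.
    by apply/eqP; apply: val_inj => /=; apply/ir_exact0; exists (val x).
  by exists (pr (Submod gZ)) => //; exists (Submod gZ).
move=> x _ _ -> [z /quot_proj_eq0/eqP-> /= x0].
by apply: val_inj; apply: (@ir_aug_inj _ _ E); rewrite -x0 linear0.
Qed.

Theorem theorem3p1 (R : comNzRingType) (a : submodClosed R^o) (M : lmodType R)
  (R_noetherian : noetherian R^o)
  (a_nonzero : exists2 r : R, r \in a & r != 0)
  (M_ZD : ZD_module M) :
  (forall N : submodClosed M, artinian (Gamma a (quotmod N))) <->
  (forall (N : submodClosed M) (i : nat)
     (E : injective_resolution (quotmod N)), artinian (local_cohomology a E i)).
Proof.
split=> [artG N i E|artH N]; last first.
  have [E] := injective_resolution_exists (quotmod N).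
  exact: gamma_local_cohomology0 (artH N 0%N E).
have gamma_art (P : M -> Prop) : submodule P -> artinian_mod (tors a P) P.
  by move=> subP; apply: gamma_quotient_artinian.
have reg_elt (P : M -> Prop) := @ZD_regular_element R a M P M_ZD.
have tcE := resolution_transform_complex a R_noetherian E.
have subN := submodule_mem N.
case: i => [|[|i]].
- exact/local_cohomology0_artinian/gamma_art.
- apply: local_cohomologyS_artinian (transform_cokernel_artinian gamma_art reg_elt subN tcE) => //.
  + exact: cobound_mod_submodule.
  + move=> y [v /cobound_cocycle/eqP]; rewrite linearB (tc_cocycle tcE) subr0.
    by move/eqP.
  move=> e [v]; rewrite /cobound resolution_mapE -linearB => /quot_proj_eq0 te.
  exists (e - ir_aug E (quot_proj N v)) => //.
  rewrite linearB /= (_ : cc_d E 0 (ir_aug E _) = 0) ?subr0 //.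
  by apply/ir_exact0; exists (quot_proj N v).
have := transform_cohomology_artinian (i := i) gamma_art reg_elt subN tcE.
rewrite add0n; apply: local_cohomologyS_artinian => //.
- exact: cobound_submodule.
- by move=> y; apply: cobound_cocycle.
move=> e [y]; have [e' <-] := quot_proj_surj y => /esym/eqP.
rewrite [cc_d _ _ _]quot_torsion_mapE -subr_eq0 => de.
exists (e - cc_d E i e'); last by rewrite linearB /= cc_dd subr0.
by apply/quot_proj_eq0; rewrite linearB; apply/eqP.
Qed.
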